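(* Let $\mathbb{E}$ be a finitely complete category. Then $\mathbb{E}$ is $\mathbb P$-decomposable (resp. stably $\mathbb P$-decomposable) if and only if the category $\mathrm{Grd}\,\mathbb{E}$ of internal groupoids in $\mathbb{E}$ has $\mathrm{DiF}$-extremal decompositions of monomorphisms (resp. stably $\mathrm{DiF}$-extremal decompositions of monomorphisms), where $\mathrm{DiF}$ is the class of discrete fibrations in $\mathrm{Grd}\,\mathbb{E}$.
   Context: Extremal decompositions. Let $\Theta$ be a class of morphisms in a category $\mathbb{D}$ and $v:U\rightarrowtail T$ a monomorphism. A decomposition $v=w.u$ with $u:U\to X$ in $\Theta$ and $w:X\to T$ is $\Theta$-extremal when for any other decomposition $v=w'.u'$ with $u':U\to X'$ in $\Theta$, there is a unique $t:X'\to X$ with $w.t=w'$ and $t.u'=u$. The category $\mathbb{D}$ has $\Theta$-extremal decompositions of monomorphisms when any monomorphism has a $\Theta$-extremal decomposition; it has stably $\Theta$-extremal decompositions of monomorphisms when moreover these $\Theta$-extremal decompositions are stable under pullback along maps in $\Theta$ (the pullback of a $\Theta$-extremal decomposition of $v:U\rightarrowtail T$ along a map $\bar T\to T$ in $\Theta$ is a $\Theta$-extremal decomposition of the pulled-back monomorphism). Points. $\mathrm{Pt}\,\mathbb{E}$ is the category whose objects are the split epimorphisms $(f,s):X\rightleftarrows Y$, $f.s=1_Y$, with chosen splitting, and whose maps $(y,x):(f',s')\to(f,s)$ are pairs $y:Y'\to Y$, $x:X'\to X$ with $f.x=y.f'$ and $x.s'=s.y$. The functor $\mathbb P_{\mathbb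 E}:\mathrm{Pt}\,\mathbb E\to\mathbb E$ sends $(f,s)$ to its codomain $Y$; a map $(y,x)$ is $\mathbb P_{\mathbb E}$-cartesian iff the square $f.x=y.f'$ is a pullback. $\mathbb{E}$ is called $\mathbb P$-decomposable (resp. stably $\mathbb P$-decomposable) when $\mathrm{Pt}\,\mathbb E$ has (resp. stably) $\Theta$-extremal decompositions of monomorphisms, with $\Theta$ the class of $\mathbb P_{\mathbb E}$-cartesian maps. An internal functor $(f_0,f_1):\underline X_1\to\underline Y_1$ between internal groupoids, with domain and codomain maps $d_0,d_1$, is a discrete fibration when the commutative square $d_0.f_1=f_0.d_0$ is a pullback (equivalently the one with $d_1$). *)

(* Defs.v *)
(* Vanilla Rocq with Stdlib only; equality of morphisms is Leibniz equality. *)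
From Stdlib Require Import FinFun ProofIrrelevance.

Set Implicit Arguments.
Unset Strict Implicit.
Unset Printing Implicit Defensive.

Declare Scope cat_scope.
Delimit Scope cat_scope with cat.
Local Open Scope cat_scope.

Record Category := {
  Ob :> Type;
  Hom : Ob -> Ob -> Type;
  idm : forall A, Hom A A;
  comp : forall A B C, Hom B C -> Hom A B -> Hom A C;
  comp_id_l : forall A B (f : Hom A B), comp (idm B) f = f;
  comp_id_r : forall A B (f : Hom A B), comp f (idm A) = f;
  comp_assoc : forall A B C D (h : Hom C D) (g : Hom B C) (f : Hom A B),
      comp h (comp g f) = comp (comp h g) f }.

Arguments Hom {c} A B.
Arguments idm {c} A.
Arguments comp {c A B C} g f.

Notation "g ∘ f" := (comp g f) (at level 40, left associativity) : cat_scope.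

Record Functor (C D : Category) := {
  fob :> C -> D;
  fmap : forall A B, Hom A B -> Hom (fob A) (fob B);
  fmap_id : forall A, fmap (idm A) = idm (fob A);
  fmap_comp : forall A B K (g : Hom B K) (f : Hom A B),
      fmap (g ∘ f) = fmap g ∘ fmap f }.

Arguments fmap {C D} F {A B} f : rename.

Definition mono {C : Category} {A B : C} (f : Hom A B) : Prop :=
  forall (Z : C) (a b : Hom Z A), f ∘ a = f ∘ b -> a = b.

(* The square with sides p, q out of P and f, g into K, where f ∘ p = g ∘ q. *)
Definition is_pullback {C : Category} {P A B K : C}
    (p : Hom P A) (q : Hom P B) (f : Hom A K) (g : Hom B K) : Prop :=
  f ∘ p = g ∘ q /\
  forall (Z : C) (a : Hom Z A) (b : Hom Z B), f ∘ a = g ∘ b ->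
    exists! u : Hom Z P, p ∘ u = a /\ q ∘ u = b.

Record Cone (J C : Category) (D : Functor J C) := {
  apex : C;
  leg : forall j : J, Hom apex (D j);
  leg_nat : forall (i j : J) (h : Hom i j), fmap D h ∘ leg i = leg j }.

Definition is_limit (J C : Category) (D : Functor J C) (L : Cone D) : Prop :=
  forall K : Cone D, exists! u : Hom (apex K) (apex L),
    forall j : J, leg L j ∘ u = leg K j.

Definition finite_category (J : Category) : Prop :=
  Finite J /\ forall i j : J, Finite (Hom i j).

Definition finitely_complete (C : Category) : Prop :=
  forall J : Category, finite_category J ->
  forall D : Functor J C, exists L : Cone D, is_limit L.

Definition cartesian (C B : Category) (F : Functor C B) (X Y : C)
    (phi : Hom X Y) : Prop :=
  forall (Z : C) (psi : Hom Z Y) (g : Hom (F Z) (F X)),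
    fmap F phi ∘ g = fmap F psi ->
    exists! chi : Hom Z X, phi ∘ chi = psi /\ fmap F chi = g.

Definition MorphismClass (C : Category) := forall A B : C, Hom A B -> Prop.

Section Extremal.
Variables (D : Category) (Theta : MorphismClass D).

Definition decomposition (U T X : D)
    (v : Hom U T) (u : Hom U X) (w : Hom X T) : Prop :=
  Theta u /\ v = w ∘ u.

Definition extremal_decomposition (U T X : D)
    (v : Hom U T) (u : Hom U X) (w : Hom X T) : Prop :=
  decomposition v u w /\
  forall (X' : D) (u' : Hom U X') (w' : Hom X' T),
    decomposition v u' w' ->
    exists! t : Hom X' X, w ∘ t = w' /\ t ∘ u' = u.

Definition has_extremal_decompositions : Prop :=
  forall (U T : D) (v : Hom U T), mono v ->
    exists (X : D) (u : Hom U X) (w : Hom X T), extremal_decomposition v u w.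

(* Given t : T' -> T in Theta, v' and w' are the pullbacks of v and w along t,
   and u' is the map they induce between the pulled-back domains. *)
Definition extremal_decompositions_stable : Prop :=
  forall (U T X : D) (v : Hom U T) (u : Hom U X) (w : Hom X T),
    mono v -> extremal_decomposition v u w ->
  forall (T' : D) (t : Hom T' T), Theta t ->
  forall (U' X' : D) (a : Hom U' U) (v' : Hom U' T')
         (x : Hom X' X) (w' : Hom X' T') (u' : Hom U' X'),
    is_pullback a v' v t ->
    is_pullback x w' w t ->
    x ∘ u' = u ∘ a -> w' ∘ u' = v' ->
    extremal_decomposition v' u' w'.

Definition has_stably_extremal_decompositions : Prop :=
  has_extremal_decompositions /\ extremal_decompositions_stable.

End Extremal.

Section Points.
Variable E : Category.

Record Point := {
  ptop : E;
  pbase : E;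
  pepi : Hom ptop pbase;
  psec : Hom pbase ptop;
  psplit : pepi ∘ psec = idm pbase }.

Record PointHom (P Q : Point) := {
  hbase : Hom (pbase P) (pbase Q);
  htop : Hom (ptop P) (ptop Q);
  hepi : pepi Q ∘ htop = hbase ∘ pepi P;
  hsec : htop ∘ psec P = psec Q ∘ hbase }.

Lemma PointHom_eq (P Q : Point) (f g : PointHom P Q) :
  hbase f = hbase g -> htop f = htop g -> f = g.
Proof.
destruct f as [fb ft e1 e2], g as [gb gt e3 e4]; simpl; intros -> ->.
f_equal; apply proof_irrelevance.
Qed.

Definition Point_id (P : Point) : PointHom P P.
Proof.
exists (idm (pbase P)) (idm (ptop P));
  rewrite comp_id_l, comp_id_r; reflexivity.
Defined.

Definition Point_comp (P Q R : Point)
    (g : PointHom Q R) (f : PointHom P Q) : PointHom P R.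
Proof.
exists (hbase g ∘ hbase f) (htop g ∘ htop f).
- rewrite comp_assoc, hepi, <- !comp_assoc, hepi; reflexivity.
- rewrite <- comp_assoc, hsec, !comp_assoc, hsec; reflexivity.
Defined.

Definition Pt : Category.
Proof.
refine {| Ob := Point; Hom := PointHom; idm := Point_id; comp := Point_comp |};
  intros; apply PointHom_eq; simpl;
  first [apply comp_id_l | apply comp_id_r | apply comp_assoc].
Defined.

Definition PtBase : Functor Pt E :=
  {| fob := (pbase : Pt -> E);
     fmap := fun (P Q : Pt) (f : Hom P Q) => hbase f;
     fmap_id := fun P => eq_refl;
     fmap_comp := fun P Q R g f => eq_refl |}.

Definition P_cartesian : MorphismClass Pt :=
  fun P Q f => cartesian PtBase f.

Definition P_decomposable : Prop := has_extremal_decompositions P_cartesian.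

Definition stably_P_decomposable : Prop :=
  has_stably_extremal_decompositions P_cartesian.

End Points.

Section Groupoids.
Variable E : Category.

(* For p0, p1 exhibiting X2 as the object of composable pairs and m : X2 -> X1:
   the pair of generalized elements (a, b) is composable, and c is the
   composite of a followed by b. *)
Definition is_composite (X1 X2 : E) (p0 p1 m : Hom X2 X1)
    (Z : E) (a b c : Hom Z X1) : Prop :=
  exists k : Hom Z X2, p0 ∘ k = a /\ p1 ∘ k = b /\ m ∘ k = c.

(* d0 is the domain and d1 the codomain; a pair (a, b) is composable when
   d1 ∘ a = d0 ∘ b. Finite completeness being mere existence of limits, the
   object of composable pairs is carried by the groupoid; being determined up
   to a unique isomorphism, it is not constrained further by morphisms. *)
Record Groupoid := {
  gob : E;
  gar : E;
  gpairs : E;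
  d0 : Hom gar gob;
  d1 : Hom gar gob;
  s0 : Hom gob gar;
  p0 : Hom gpairs gar;
  p1 : Hom gpairs gar;
  gm : Hom gpairs gar;
  ginv : Hom gar gar;
  gpairs_pullback : is_pullback p0 p1 d1 d0;
  d0_s0 : d0 ∘ s0 = idm gob;
  d1_s0 : d1 ∘ s0 = idm gob;
  d0_gm : d0 ∘ gm = d0 ∘ p0;
  d1_gm : d1 ∘ gm = d1 ∘ p1;
  gm_id_l : is_composite p0 p1 gm (s0 ∘ d0) (idm gar) (idm gar);
  gm_id_r : is_composite p0 p1 gm (idm gar) (s0 ∘ d1) (idm gar);
  gm_assoc : forall (Z : E) (a b c ab bc abc : Hom Z gar),
      is_composite p0 p1 gm a b ab ->
      is_composite p0 p1 gm b c bc ->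
      is_composite p0 p1 gm ab c abc ->
      is_composite p0 p1 gm a bc abc;
  d0_ginv : d0 ∘ ginv = d1;
  d1_ginv : d1 ∘ ginv = d0;
  gm_inv_r : is_composite p0 p1 gm (idm gar) ginv (s0 ∘ d0);
  gm_inv_l : is_composite p0 p1 gm ginv (idm gar) (s0 ∘ d1) }.

Arguments d0 {g}.
Arguments d1 {g}.
Arguments s0 {g}.
Arguments p0 {g}.
Arguments p1 {g}.
Arguments gm {g}.
Arguments ginv {g}.

Record GroupoidHom (X Y : Groupoid) := {
  f0 : Hom (gob X) (gob Y);
  f1 : Hom (gar X) (gar Y);
  f_d0 : d0 ∘ f1 = f0 ∘ d0;
  f_d1 : d1 ∘ f1 = f0 ∘ d1;
  f_s0 : f1 ∘ s0 = s0 ∘ f0;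
  f_gm : is_composite p0 p1 gm (f1 ∘ p0) (f1 ∘ p1) (f1 ∘ gm) }.

Lemma GroupoidHom_eq (X Y : Groupoid) (f g : GroupoidHom X Y) :
  f0 f = f0 g -> f1 f = f1 g -> f = g.
Proof.
destruct f as [a b h1 h2 h3 h4], g as [c d k1 k2 k3 k4]; simpl; intros -> ->.
f_equal; apply proof_irrelevance.
Qed.

Definition Groupoid_id (X : Groupoid) : GroupoidHom X X.
Proof.
exists (idm (gob X)) (idm (gar X)).
1-3: rewrite comp_id_l, comp_id_r; reflexivity.
exists (idm (gpairs X)); rewrite !comp_id_l, !comp_id_r; auto.
Defined.

Definition Groupoid_comp (X Y Z : Groupoid)
    (g : GroupoidHom Y Z) (f : GroupoidHom X Y) : GroupoidHom X Z.
Proof.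
exists (f0 g ∘ f0 f) (f1 g ∘ f1 f).
- rewrite comp_assoc, f_d0, <- !comp_assoc, f_d0; reflexivity.
- rewrite comp_assoc, f_d1, <- !comp_assoc, f_d1; reflexivity.
- rewrite <- comp_assoc, f_s0, !comp_assoc, f_s0; reflexivity.
- destruct (f_gm f) as [h [h1 [h2 h3]]], (f_gm g) as [k [k1 [k2 k3]]].
  exists (k ∘ h); rewrite !comp_assoc, k1, k2, k3, <- !comp_assoc, h1, h2, h3.
  auto.
Defined.

Definition Grd : Category.
Proof.
refine {| Ob := Groupoid; Hom := GroupoidHom;
          idm := Groupoid_id; comp := Groupoid_comp |};
  intros; apply GroupoidHom_eq; simpl;
  first [apply comp_id_l | apply comp_id_r | apply comp_assoc].
Defined.

Definition DiF : MorphismClass Grd :=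
  fun X Y (f : GroupoidHom X Y) => is_pullback (f1 f) d0 d0 (f0 f).

End Groupoids.

Arguments d0 {E g}.
Arguments d1 {E g}.
Arguments s0 {E g}.
Arguments p0 {E g}.
Arguments p1 {E g}.
Arguments gm {E g}.
Arguments ginv {E g}.

(* Main.v *)
From Stdlib Require Import List ClassicalEpsilon.
Require Import Defs.

(** The functor [Source] from groupoids to points that keeps the source map of a
    groupoid together with its identities is monadic. The free groupoid on a
    point is the kernel pair of its split epimorphism [f], with section [s],
    seen as an equivalence relation; the unit sends [x] to the pair [(s f x, x)],
    and the action of a groupoid sends a pair [(a, b)] of arrows with a common
    source to [a^-1 b]. Discrete fibrations are exactly the internal functors
    with a cartesian image under [Source]. The monad is cartesian: it preserves
    pullbacks, it preserves cartesian maps, and its unit is cartesian. The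
    theorem follows for any monadic functor [U : G -> D] with monad [T] and any
    class [Theta] of maps of [D] with these properties ([Monadic], [Adapted]),
    the class in [G] being that of the maps with image in [Theta].

    From [D] to [G]: let [v : X -> Y] be a monomorphism of algebras and
    [U X -> P -> U Y] an extremal decomposition of [U v] in [D]. The unit is in
    [Theta], so [U X -> P -> T P] is in [Theta], and [T P -> T U Y -> U Y]
    completes it to another decomposition of [U v]. Extremality of [P] yields a
    map [T P -> P], and its uniqueness clause yields the laws of an algebra
    ([lift_extremal]). By the same argument a map into [P] that mediates between
    decompositions in [G] is a map of algebras, so that a decomposition in [G] is
    extremal when its image is ([reflect_extremal]).

    From [G] to [D]: let [v : B -> C] be a monomorphism of [D], [F] the free
    algebra functor and [F B -> X -> F C] an extremal decomposition of [F v].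
    Since maps [F Q -> X] correspond to maps [Q -> U X], the pullback of [U X]
    along the unit [C -> T C] is an extremal decomposition of [v]
    ([descend_extremal]).

    Both constructions commute with pullback, because [U] and [F] preserve
    pullbacks and extremal decompositions are unique up to isomorphism
    ([stability_of_algebras], [stability_of_base]). *)

Set Implicit Arguments.
Unset Strict Implicit.
Unset Printing Implicit Defensive.

Local Open Scope cat_scope.

(** * Pullbacks, isomorphisms and cartesian maps *)

Lemma comp_reassoc (C : Category) (X Y Z : C)
    (g : Hom Y Z) (f : Hom X Y) (h : Hom X Z) (e : g ∘ f = h)
    (W : C) (k : Hom W X) : g ∘ (f ∘ k) = h ∘ k.
Proof. rewrite comp_assoc, e; reflexivity. Qed.

(** Composites are kept associated to the right; [rw e] rewrites with an
    equation [e] between composites also when its left-hand side is followed by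
    further factors. *)
Ltac rassoc := rewrite <- ?comp_assoc.
Ltac rw e :=
  rassoc;
  first [ rewrite e | rewrite (comp_reassoc e) ];
  rassoc.

Section Pullbacks.
Variable C : Category.

Lemma pullback_intro (P A B K : C)
    (p : Hom P A) (q : Hom P B) (f : Hom A K) (g : Hom B K) :
  f ∘ p = g ∘ q ->
  (forall (Z : C) (a : Hom Z A) (b : Hom Z B), f ∘ a = g ∘ b ->
    exists u : Hom Z P, p ∘ u = a /\ q ∘ u = b) ->
  (forall (Z : C) (u v : Hom Z P), p ∘ u = p ∘ v -> q ∘ u = q ∘ v -> u = v) ->
  is_pullback p q f g.
Proof.
intros sq ex joint; split; [exact sq|]; intros Z a b e.
destruct (ex Z a b e) as [u [u1 u2]]; exists u; split; [auto|].
intros v [v1 v2]; apply joint; congruence.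
Qed.

Lemma pullback_pair (P A B K : C)
    (p : Hom P A) (q : Hom P B) (f : Hom A K) (g : Hom B K) :
  is_pullback p q f g ->
  forall (Z : C) (a : Hom Z A) (b : Hom Z B), f ∘ a = g ∘ b ->
  exists u : Hom Z P, p ∘ u = a /\ q ∘ u = b.
Proof. intros [_ H] Z a b e; destruct (H Z a b e) as [u [hu _]]; eauto. Qed.

Lemma pullback_joint (P A B K : C)
    (p : Hom P A) (q : Hom P B) (f : Hom A K) (g : Hom B K) :
  is_pullback p q f g ->
  forall (Z : C) (u v : Hom Z P), p ∘ u = p ∘ v -> q ∘ u = q ∘ v -> u = v.
Proof.
intros [sq H] Z u v e1 e2.
destruct (H Z (p ∘ u) (q ∘ u)) as [w [_ hw]].
- rewrite !comp_assoc, sq; reflexivity.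
- transitivity w; [symmetry|]; apply hw; auto.
Qed.

Lemma mono_of_kernel_pair (A B : C) (v : Hom A B) :
  is_pullback (idm A) (idm A) v v -> mono v.
Proof.
intros [_ H] Z a b e; destruct (H Z a b e) as [u [[u1 u2] _]].
rewrite comp_id_l in u1, u2; congruence.
Qed.

Lemma kernel_pair_of_mono (A B : C) (v : Hom A B) :
  mono v -> is_pullback (idm A) (idm A) v v.
Proof.
intros m; apply pullback_intro; auto.
- intros Z a b e; exists a; rewrite comp_id_l; split; auto.
- intros Z a b; rewrite !comp_id_l; auto.
Qed.

Lemma pullback_paste (P' P X B' B K : C)
    (x' : Hom P' P) (x : Hom P X) (q' : Hom P' B') (q : Hom P B)
    (f : Hom X K) (t' : Hom B' B) (t : Hom B K) :
  is_pullback x q f t -> is_pullback x' q' q t' ->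
  is_pullback (x ∘ x') q' f (t ∘ t').
Proof.
intros r l; apply pullback_intro.
- rw (proj1 r); rw (proj1 l); reflexivity.
- intros Z a b e; rewrite <- comp_assoc in e.
  destruct (pullback_pair r e) as [u [u1 u2]].
  destruct (pullback_pair l u2) as [v [v1 v2]].
  exists v; split; [rw v1|]; auto.
- intros Z u v e1 e2; rewrite <- !comp_assoc in e1.
  apply (pullback_joint l); auto; apply (pullback_joint r); auto.
  rewrite !comp_assoc, (proj1 l), <- !comp_assoc, e2; reflexivity.
Qed.

Lemma pullback_cancel (P' P X B' B K : C)
    (x' : Hom P' P) (x : Hom P X) (q' : Hom P' B') (q : Hom P B)
    (f : Hom X K) (t' : Hom B' B) (t : Hom B K) :
  is_pullback x q f t -> q ∘ x' = t' ∘ q' ->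
  is_pullback (x ∘ x') q' f (t ∘ t') ->
  is_pullback x' q' q t'.
Proof.
intros r sq o; apply pullback_intro; auto.
- intros Z a b e.
  destruct (pullback_pair o (a := x ∘ a) (b := b)) as [u [u1 u2]].
  + rw (proj1 r); rewrite e; reflexivity.
  + exists u; split; auto; apply (pullback_joint r).
    * rassoc; rewrite <- u1; rassoc; reflexivity.
    * rw sq; rewrite u2; auto.
- intros Z u v e1 e2; apply (pullback_joint o); auto.
  rassoc; rewrite e1; reflexivity.
Qed.

Definition inverse (A B : C) (j : Hom A B) (k : Hom B A) : Prop :=
  j ∘ k = idm B /\ k ∘ j = idm A.

Lemma pullback_iso (P' P A B K : C) (j : Hom P' P) (k : Hom P P')
    (p : Hom P A) (q : Hom P B) (f : Hom A K) (g : Hom B K) :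
  inverse j k -> is_pullback p q f g -> is_pullback (p ∘ j) (q ∘ j) f g.
Proof.
intros [jk kj] pb; apply pullback_intro.
- rw (proj1 pb); reflexivity.
- intros Z a b e; destruct (pullback_pair pb e) as [u [u1 u2]].
  exists (k ∘ u); split; rassoc; rewrite (comp_reassoc jk), comp_id_l; auto.
- intros Z u v e1 e2.
  assert (e : j ∘ u = j ∘ v)
    by (apply (pullback_joint pb); rewrite !comp_assoc; auto).
  rewrite <- (comp_id_l u), <- (comp_id_l v), <- kj, <- !comp_assoc, e.
  reflexivity.
Qed.

Lemma pullback_unique (P' P A B K : C)
    (p' : Hom P' A) (q' : Hom P' B) (p : Hom P A) (q : Hom P B)
    (f : Hom A K) (g : Hom B K) :
  is_pullback p' q' f g -> is_pullback p q f g ->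
  exists (j : Hom P' P) (k : Hom P P'),
    inverse j k /\ p ∘ j = p' /\ q ∘ j = q'.
Proof.
intros l r.
destruct (pullback_pair r (proj1 l)) as [j [j1 j2]].
destruct (pullback_pair l (proj1 r)) as [k [k1 k2]].
exists j, k; repeat split; auto.
- apply (pullback_joint r); rewrite comp_id_r; [rw j1|rw j2]; auto.
- apply (pullback_joint l); rewrite comp_id_r; [rw k1|rw k2]; auto.
Qed.

End Pullbacks.

Section Cartesian.
Variables (C B : Category) (F : Functor C B).

Lemma cartesian_comp (X Y Z : C) (g : Hom Y Z) (f : Hom X Y) :
  cartesian F g -> cartesian F f -> cartesian F (g ∘ f).
Proof.
intros hg hf W psi b e; rewrite fmap_comp, <- comp_assoc in e.
destruct (hg W psi _ e) as [y [[y1 y2] uy]].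
destruct (hf W y b (eq_sym y2)) as [x [[x1 x2] ux]].
exists x; split.
- split; [rw x1|]; auto.
- intros x' [e1 e2]; apply ux; split; auto.
  symmetry; apply uy; split; [rewrite comp_assoc; auto|].
  rewrite fmap_comp, e2; reflexivity.
Qed.

Lemma cartesian_cancel (X Y Z : C) (g : Hom Y Z) (f : Hom X Y) :
  cartesian F g -> cartesian F (g ∘ f) -> cartesian F f.
Proof.
intros hg hgf W psi b e.
destruct (hgf W (g ∘ psi) b) as [x [[x1 x2] ux]].
- rewrite !fmap_comp, <- comp_assoc, e; reflexivity.
- exists x; split.
  + split; [|exact x2].
    destruct (hg W (g ∘ psi) (fmap F psi)) as [y [_ uy]].
    * rewrite fmap_comp; reflexivity.
    * transitivity y; [symmetry|]; apply uy; split; auto.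
      -- rewrite comp_assoc; exact x1.
      -- rewrite fmap_comp, x2; exact e.
  + intros x' [e1 e2]; apply ux; split; [rassoc; rewrite e1|]; auto.
Qed.

Lemma cartesian_iso (X Y : C) (j : Hom X Y) (k : Hom Y X) :
  inverse j k -> cartesian F j.
Proof.
intros [jk kj] W psi b e; exists (k ∘ psi); split.
- split; [rw jk; apply comp_id_l|].
  rewrite fmap_comp, <- e, comp_assoc, <- fmap_comp, kj, fmap_id.
  apply comp_id_l.
- intros x [<- _]; rw kj; apply comp_id_l.
Qed.

(** The vertical part of the required factorization comes from the cartesian map
    [g], and the pullback in the base forces the result to lie over the
    prescribed map. *)
Lemma cartesian_pullback (P X Y K : C)
    (p : Hom P X) (q : Hom P Y) (f : Hom X K) (g : Hom Y K) :
  is_pullback p q f g ->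
  is_pullback (fmap F p) (fmap F q) (fmap F f) (fmap F g) ->
  cartesian F g -> cartesian F p.
Proof.
intros pb pbF hg W psi b e.
destruct (hg W (f ∘ psi) (fmap F q ∘ b)) as [y [[y1 y2] uy]].
{ rewrite fmap_comp, <- e, comp_assoc, <- (proj1 pbF), <- comp_assoc; auto. }
destruct (pullback_pair pb (eq_sym y1)) as [x [x1 x2]].
exists x; split.
- split; [exact x1|]; apply (pullback_joint pbF); rewrite <- fmap_comp.
  + rewrite x1; auto.
  + rewrite x2; auto.
- intros x' [e1 e2]; apply (pullback_joint pb); [congruence|].
  rewrite x2; apply uy; split.
  + rewrite comp_assoc, <- (proj1 pb), <- comp_assoc, e1; reflexivity.
  + rewrite fmap_comp, e2; reflexivity.
Qed.

End Cartesian.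

(** * Pullbacks from finite limits *)

Inductive cospan : Type := cospan_left | cospan_right | cospan_center.

Definition cospan_arrow (i j : cospan) : bool :=
  match i, j with
  | cospan_left, cospan_left | cospan_right, cospan_right
  | _, cospan_center => true
  | _, _ => false
  end.

Definition cospan_hom (i j : cospan) : Type :=
  if cospan_arrow i j then unit else Empty_set.

Definition cospan_id (i : cospan) : cospan_hom i i :=
  match i with cospan_left | cospan_right | cospan_center => tt end.

Definition cospan_comp (i j k : cospan) :
  cospan_hom j k -> cospan_hom i j -> cospan_hom i k.
Proof.
destruct i, j, k; cbn; intros g f; first [exact tt | contradiction].
Defined.

Definition Cospan : Category.
Proof.
refine {| Ob := cospan; Hom := cospan_hom;
          idm := cospan_id; comp := cospan_comp |}.
- intros [] [] []; reflexivity.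
- intros [] [] []; reflexivity.
- intros [] [] [] []; cbn; intros h g f;
    first [reflexivity | contradiction].
Defined.

Lemma Cospan_finite : finite_category Cospan.
Proof.
split.
- exists (cospan_left :: cospan_right :: cospan_center :: nil).
  intros []; cbn; auto.
- intros [] []; cbn; first
    [ exists nil; intros h; contradiction
    | exists (tt :: nil); intros []; cbn; auto ].
Qed.

Section CospanDiagram.
Variables (C : Category) (A B K : C) (f : Hom A K) (g : Hom B K).

Definition cospan_ob (i : cospan) : C :=
  match i with
  | cospan_left => A | cospan_right => B | cospan_center => K
  end.

Definition cospan_map (i j : cospan) :
  cospan_hom i j -> Hom (cospan_ob i) (cospan_ob j).
Proof.
destruct i, j; cbn; intros h;
  first [exact (idm _) | exact f | exact g | contradiction].
Defined.

Definition cospan_diagram : Functor Cospan C.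
Proof.
refine {| fob := cospan_ob : Cospan -> C; fmap := cospan_map |}.
- intros []; reflexivity.
- intros [] [] []; cbn; intros h k;
    first [ contradiction
          | rewrite ?comp_id_l, ?comp_id_r; reflexivity].
Defined.

Definition cospan_cone (Z : C) (a : Hom Z A) (b : Hom Z B)
  (e : f ∘ a = g ∘ b) : Cone cospan_diagram.
Proof.
refine {| apex := Z; leg := fun i : Cospan =>
  match i as i return Hom Z (cospan_diagram i) with
  | cospan_left => a | cospan_right => b | cospan_center => f ∘ a end |}.
intros [] []; cbn; intros h;
  first [contradiction | rewrite ?comp_id_l; auto].
Defined.

Lemma pullback_exists : finitely_complete C ->
  exists (P : C) (p : Hom P A) (q : Hom P B), is_pullback p q f g.
Proof.
intros hC; destruct (hC _ Cospan_finite cospan_diagram) as [L hL].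
exists (apex L), (leg L cospan_left), (leg L cospan_right).
pose proof (leg_nat L (i := cospan_left) (j := cospan_center) tt) as nl.
pose proof (leg_nat L (i := cospan_right) (j := cospan_center) tt) as nr.
cbn in nl, nr.
split; [congruence|].
intros Z a b e; destruct (hL (cospan_cone e)) as [u [hu uu]].
exists u; split.
- split; [apply (hu cospan_left)|apply (hu cospan_right)].
- intros v [v1 v2]; apply uu; intros []; cbn; auto.
  rewrite <- nl, <- v1, comp_assoc; reflexivity.
Qed.

End CospanDiagram.

(** * Extremal decompositions up to isomorphism *)

Section ExtremalIso.
Variables (D : Category) (Theta : MorphismClass D).

Lemma extremal_unique (A B X X' : D) (v : Hom A B)
    (u : Hom A X) (w : Hom X B) (u' : Hom A X') (w' : Hom X' B) :
  extremal_decomposition Theta v u w -> extremal_decomposition Theta v u' w' ->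
  exists (j : Hom X X') (k : Hom X' X),
    inverse j k /\ w' ∘ j = w /\ j ∘ u = u' /\ w ∘ k = w' /\ k ∘ u' = u.
Proof.
intros [d e] [d' e'].
destruct (e' _ _ _ d) as [j [[j1 j2] _]], (e _ _ _ d') as [k [[k1 k2] _]].
exists j, k; repeat split; auto.
- destruct (e' _ _ _ d') as [t [_ ut]].
  transitivity t; [symmetry|]; apply ut; split;
    rewrite ?comp_id_l, ?comp_id_r; auto.
  + rw j1; auto.
  + rw k2; auto.
- destruct (e _ _ _ d) as [t [_ ut]].
  transitivity t; [symmetry|]; apply ut; split;
    rewrite ?comp_id_l, ?comp_id_r; auto.
  + rw k1; auto.
  + rw j2; auto.
Qed.

Lemma extremal_transport (A B X X' : D) (v : Hom A B)
    (u : Hom A X) (w : Hom X B) (u' : Hom A X') (w' : Hom X' B)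
    (j : Hom X' X) (k : Hom X X') :
  extremal_decomposition Theta v u w -> inverse j k ->
  w ∘ j = w' -> j ∘ u' = u -> Theta u' ->
  extremal_decomposition Theta v u' w'.
Proof.
intros [[_ d] e] [jk kj] jw ju hu'; split; [split; auto|].
{ rewrite <- jw, d, <- ju, comp_assoc; reflexivity. }
intros Y y z dY; destruct (e Y y z dY) as [t [[t1 t2] ut]].
exists (k ∘ t); split.
- split.
  + rewrite <- jw; rassoc; rewrite (comp_reassoc jk), comp_id_l; auto.
  + rassoc; rewrite t2, <- ju; rw kj; apply comp_id_l.
- intros t' [e1 e2]; rewrite (ut (j ∘ t')).
  + rw kj; apply comp_id_l.
  + split; [rewrite comp_assoc, jw|rassoc; rewrite e2]; auto.
Qed.

End ExtremalIso.

(** * Extremal decompositions of the algebras of a cartesian monad *)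

Section Transfer.
Variables (D G : Category) (U : Functor G D).

(** An adjunction with right adjoint [U], given by universal arrows, whose
    comparison functor to the algebras of its monad is faithful, full and
    essentially surjective. The composite
    [fmap U (transpose (eta Q ∘ h))] is the value of the monad at [h], and
    [fmap U (transpose (idm (U X)))] is the action of the algebra [X]. The
    multiplication of the monad at [P] is the action of the free algebra on
    [P]. *)
Record Monadic := {
  free : D -> G;
  eta : forall P, Hom P (U (free P));
  transpose : forall P X, Hom P (U X) -> Hom (free P) X;
  transpose_unit : forall P X (h : Hom P (U X)),
    fmap U (transpose h) ∘ eta P = h;
  transpose_unique : forall P X (k k' : Hom (free P) X),
    fmap U k ∘ eta P = fmap U k' ∘ eta P -> k = k';
  faithful : forall X Y (k k' : Hom X Y), fmap U k = fmap U k' -> k = k';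
  lift_hom : forall X Y (h : Hom (U X) (U Y)),
    h ∘ fmap U (transpose (idm (U X)))
      = fmap U (transpose (idm (U Y)))
          ∘ fmap U (transpose (eta (U Y) ∘ h)) ->
    exists k : Hom X Y, fmap U k = h;
  lift_algebra : forall P (a : Hom (U (free P)) P),
    a ∘ eta P = idm P ->
    a ∘ fmap U (transpose (eta P ∘ a))
      = a ∘ fmap U (transpose (idm (U (free P)))) ->
    exists X (i : Hom (U X) P) (k : Hom P (U X)), inverse i k /\
      i ∘ fmap U (transpose (idm (U X)))
        = a ∘ fmap U (transpose (eta P ∘ i)) }.

Variable M : Monadic.

Definition free_map (P Q : D) (h : Hom P Q) : Hom (free M P) (free M Q) :=
  transpose M (eta M Q ∘ h).

Definition monad_map (P Q : D) (h : Hom P Q)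
  : Hom (U (free M P)) (U (free M Q)) :=
  fmap U (free_map h).

Definition action (X : G) : Hom (U (free M (U X))) (U X) :=
  fmap U (transpose M (idm (U X))).

Lemma unit_natural (P Q : D) (h : Hom P Q) :
  monad_map h ∘ eta M P = eta M Q ∘ h.
Proof. apply transpose_unit. Qed.

Lemma free_map_unit (P Q : D) (h : Hom P Q) :
  fmap U (free_map h) ∘ eta M P = eta M Q ∘ h.
Proof. apply transpose_unit. Qed.

Lemma action_unit (X : G) : action X ∘ eta M (U X) = idm (U X).
Proof. apply transpose_unit. Qed.

Lemma free_map_comp (P Q R : D) (g : Hom Q R) (f : Hom P Q) :
  free_map (g ∘ f) = free_map g ∘ free_map f.
Proof.
apply (transpose_unique (m := M)); rewrite fmap_comp.
rassoc; rewrite !free_map_unit, (comp_reassoc (free_map_unit g)).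
rassoc; reflexivity.
Qed.

Lemma monad_map_comp (P Q R : D) (g : Hom Q R) (f : Hom P Q) :
  monad_map (g ∘ f) = monad_map g ∘ monad_map f.
Proof. unfold monad_map; rewrite free_map_comp; apply fmap_comp. Qed.

Lemma monad_map_id (P : D) : monad_map (idm P) = idm (U (free M P)).
Proof.
unfold monad_map; rewrite <- fmap_id; f_equal.
apply (transpose_unique (m := M)).
rewrite free_map_unit, fmap_id, comp_id_l, comp_id_r; reflexivity.
Qed.

Lemma action_natural (X Y : G) (k : Hom X Y) :
  fmap U k ∘ action X = action Y ∘ monad_map (fmap U k).
Proof.
unfold action, monad_map; rewrite <- !fmap_comp; f_equal.
apply (transpose_unique (m := M)); rewrite !fmap_comp.
rassoc; rewrite free_map_unit, transpose_unit.
rewrite (comp_reassoc (transpose_unit M _)), comp_id_l, comp_id_r; reflexivity.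
Qed.

Lemma monad_map_action (P Q : D) (h : Hom P Q) :
  monad_map h ∘ action (free M P)
    = action (free M Q) ∘ monad_map (monad_map h).
Proof. apply (action_natural (free_map h)). Qed.

Lemma action_assoc (X : G) :
  action X ∘ monad_map (action X) = action X ∘ action (free M (U X)).
Proof. symmetry; apply (action_natural (transpose M (idm (U X)))). Qed.

(** The associativity of the action on [X] passes to [a] along a compatible map
    [p]; where such maps are jointly monomorphic, or separated by uniqueness in
    an extremal object, [a] itself is associative. *)
Lemma compatible_assoc (P : D) (X : G) (a : Hom (U (free M P)) P)
    (p : Hom P (U X)) :
  p ∘ a = action X ∘ monad_map p ->
  p ∘ (a ∘ monad_map a) = p ∘ (a ∘ action (free M P)).
Proof.
intros e; rewrite !(comp_reassoc e); rassoc.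
rewrite <- monad_map_comp, e, monad_map_comp, monad_map_action.
rewrite (comp_reassoc (action_assoc X)); rassoc; reflexivity.
Qed.

Lemma forget_mono (X Y : G) (v : Hom X Y) : mono v -> mono (fmap U v).
Proof.
intros m Z a b e.
rewrite <- (transpose_unit M a), <- (transpose_unit M b).
f_equal; f_equal; apply m, (transpose_unique (m := M)).
rewrite !fmap_comp; rassoc; rewrite !transpose_unit; exact e.
Qed.

Lemma forget_pullback (P A B K : G)
    (p : Hom P A) (q : Hom P B) (f : Hom A K) (g : Hom B K) :
  is_pullback p q f g ->
  is_pullback (fmap U p) (fmap U q) (fmap U f) (fmap U g).
Proof.
intros pb; apply pullback_intro.
- rewrite <- !fmap_comp, (proj1 pb); reflexivity.
- intros Z a b e.
  destruct (pullback_pair pb (a := transpose M a) (b := transpose M b))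
    as [u [u1 u2]].
  + apply (transpose_unique (m := M)); rewrite !fmap_comp; rassoc.
    rewrite !transpose_unit; exact e.
  + exists (fmap U u ∘ eta M Z); rewrite !comp_assoc, <- !fmap_comp, u1, u2.
    rewrite !transpose_unit; auto.
- intros Z a b e1 e2.
  rewrite <- (transpose_unit M a), <- (transpose_unit M b).
  f_equal; f_equal; apply (pullback_joint pb);
    apply (transpose_unique (m := M));
    rewrite !fmap_comp; rassoc; rewrite !transpose_unit; auto.
Qed.

(** The mediating map is compatible with the actions because its two
    components are. *)
Lemma reflect_pullback (P A B K : G)
    (p : Hom P A) (q : Hom P B) (f : Hom A K) (g : Hom B K) :
  is_pullback (fmap U p) (fmap U q) (fmap U f) (fmap U g) ->
  is_pullback p q f g.
Proof.
intros pb; apply pullback_intro.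
- apply (faithful M); rewrite !fmap_comp; apply pb.
- intros Z a b e; apply (f_equal (fmap U)) in e; rewrite !fmap_comp in e.
  destruct (pullback_pair pb e) as [u [u1 u2]].
  destruct (lift_hom (m := M) (h := u)) as [k hk].
  + change (u ∘ action Z = action P ∘ monad_map u).
    apply (pullback_joint pb);
      rewrite (comp_reassoc (action_natural _)); rassoc;
      rewrite <- monad_map_comp, comp_assoc;
      rewrite ?u1, ?u2; apply action_natural.
  + exists k; split; apply (faithful M); rewrite fmap_comp, hk; auto.
- intros Z u v e1 e2; apply (faithful M), (pullback_joint pb);
    rewrite <- !fmap_comp; congruence.
Qed.

Variables (Theta : MorphismClass D) (Psi : MorphismClass G).

(** [Theta] behaves like the cartesian maps of a fibration, and the monad is
    cartesian relative to it. The unit being in [Theta] is what turns the free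
    algebra on a decomposing object into a competitor of that object; preservation
    of pullbacks makes free algebras compatible with monomorphisms and with
    change of base. *)
Record Adapted : Prop := {
  Psi_iff : forall (X Y : G) (f : Hom X Y), Psi f <-> Theta (fmap U f);
  Theta_comp : forall (X Y Z : D) (g : Hom Y Z) (f : Hom X Y),
    Theta g -> Theta f -> Theta (g ∘ f);
  Theta_cancel : forall (X Y Z : D) (g : Hom Y Z) (f : Hom X Y),
    Theta g -> Theta (g ∘ f) -> Theta f;
  Theta_iso : forall (X Y : D) (j : Hom X Y) (k : Hom Y X),
    inverse j k -> Theta j;
  Theta_pullback : forall (P A B K : D)
      (p : Hom P A) (q : Hom P B) (f : Hom A K) (g : Hom B K),
    is_pullback p q f g -> Theta g -> Theta p;
  has_pullbacks : forall (A B K : D) (f : Hom A K) (g : Hom B K),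
    exists (P : D) (p : Hom P A) (q : Hom P B), is_pullback p q f g;
  monad_pullback : forall (P A B K : D)
      (p : Hom P A) (q : Hom P B) (f : Hom A K) (g : Hom B K),
    is_pullback p q f g ->
    is_pullback (monad_map p) (monad_map q) (monad_map f) (monad_map g);
  Theta_monad_map : forall (P Q : D) (h : Hom P Q),
    Theta h -> Theta (monad_map h);
  Theta_unit : forall P : D, Theta (eta M P) }.

Hypothesis A : Adapted.

Lemma free_map_Psi (P Q : D) (h : Hom P Q) : Theta h -> Psi (free_map h).
Proof. intros H; apply (Psi_iff A), (Theta_monad_map A), H. Qed.

Lemma free_map_pullback (P B C K : D)
    (p : Hom P B) (q : Hom P C) (f : Hom B K) (g : Hom C K) :
  is_pullback p q f g ->
  is_pullback (free_map p) (free_map q) (free_map f) (free_map g).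
Proof. intros pb; apply reflect_pullback, (monad_pullback A), pb. Qed.

Lemma free_map_mono (P Q : D) (v : Hom P Q) : mono v -> mono (free_map v).
Proof.
intros m; apply mono_of_kernel_pair, reflect_pullback.
rewrite fmap_id, <- monad_map_id.
apply (monad_pullback A), kernel_pair_of_mono, m.
Qed.

(** The pullback of the underlying objects carries an algebra structure, since
    its projections to the two algebras are jointly monomorphic. *)
Lemma algebra_pullbacks (X Y K : G) (f : Hom X K) (g : Hom Y K) :
  exists (P : G) (p : Hom P X) (q : Hom P Y), is_pullback p q f g.
Proof.
destruct (has_pullbacks A (fmap U f) (fmap U g)) as [P [p [q pb]]].
destruct (pullback_pair pb
  (a := action X ∘ monad_map p) (b := action Y ∘ monad_map q)) as [a [a1 a2]].
{ rewrite (comp_reassoc (action_natural f)), (comp_reassoc (action_natural g)).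
  rassoc; rewrite <- !monad_map_comp, (proj1 pb); reflexivity. }
destruct (lift_algebra (m := M) (P := P) (a := a)) as [Q [i [k [ik hi]]]].
- apply (pullback_joint pb); rewrite comp_id_r.
  + rewrite (comp_reassoc a1); rassoc; rewrite unit_natural.
    rewrite (comp_reassoc (action_unit X)); apply comp_id_l.
  + rewrite (comp_reassoc a2); rassoc; rewrite unit_natural.
    rewrite (comp_reassoc (action_unit Y)); apply comp_id_l.
- change (a ∘ monad_map a = a ∘ action (free M P)).
  apply (pullback_joint pb); apply compatible_assoc; assumption.
- change (i ∘ action Q = a ∘ monad_map i) in hi.
  destruct (lift_hom (m := M) (X := Q) (Y := X) (h := p ∘ i)) as [p' hp].
  { change ((p ∘ i) ∘ action Q = action X ∘ monad_map (p ∘ i)).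
    rassoc; rewrite hi, (comp_reassoc a1); rassoc.
    rewrite <- monad_map_comp; reflexivity. }
  destruct (lift_hom (m := M) (X := Q) (Y := Y) (h := q ∘ i)) as [q' hq].
  { change ((q ∘ i) ∘ action Q = action Y ∘ monad_map (q ∘ i)).
    rassoc; rewrite hi, (comp_reassoc a2); rassoc.
    rewrite <- monad_map_comp; reflexivity. }
  exists Q, p', q'; apply reflect_pullback; rewrite hp, hq.
  apply (pullback_iso ik pb).
Qed.

(** A map between underlying objects that mediates between two decompositions
    in [D] commutes with the actions: both composites mediate between the same
    decompositions, the first one being prolonged by the unit, which lies in
    [Theta]. *)
Lemma reflect_extremal (X Y P : G)
    (v : Hom X Y) (u : Hom X P) (w : Hom P Y) :
  extremal_decomposition Theta (fmap U v) (fmap U u) (fmap U w) ->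
  extremal_decomposition Psi v u w.
Proof.
intros [[hu dv] ext]; split; [split|].
- apply (Psi_iff A), hu.
- apply (faithful M); rewrite fmap_comp; exact dv.
- intros Q u' w' [hu' dv']; apply (Psi_iff A) in hu'.
  apply (f_equal (fmap U)) in dv'; rewrite fmap_comp in dv'.
  destruct (ext _ _ _ (conj hu' dv')) as [t [[t1 t2] ut]].
  destruct (lift_hom (m := M) (X := Q) (Y := P) (h := t)) as [k hk].
  { change (t ∘ action Q = action P ∘ monad_map t).
    destruct (ext _ (eta M (U Q) ∘ fmap U u') (fmap U w' ∘ action Q))
      as [s [_ us]].
    - split; [apply (Theta_comp A); [apply (Theta_unit A)|exact hu']|].
      rassoc; rewrite (comp_reassoc (action_unit Q)), comp_id_l; exact dv'.
    - transitivity s; [symmetry|]; apply us; split; rassoc.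
      + rw t1; reflexivity.
      + rewrite (comp_reassoc (action_unit Q)), comp_id_l; exact t2.
      + rewrite (comp_reassoc (action_natural w)); rassoc.
        rewrite <- monad_map_comp, t1; symmetry; apply action_natural.
      + rewrite (comp_reassoc (unit_natural t)); rassoc.
        rewrite (comp_reassoc (action_unit P)), comp_id_l; exact t2. }
  exists k; split.
  + split; apply (faithful M); rewrite fmap_comp, hk; auto.
  + intros k' [e1 e2]; apply (faithful M); rewrite hk; apply ut.
    rewrite <- !fmap_comp, e1, e2; auto.
Qed.

(** With [T] the monad, [U X -> P -> T P] lies in [Theta] and is completed by
    [T P -> T U Y -> U Y] to a decomposition of the underlying map of [v];
    comparing it with [P] gives a map [T P -> P]. The laws of an algebra, and the
    compatibility of [U X -> P] with the actions, are equalities of maps into the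
    extremal object [P], hence follow from uniqueness. *)
Lemma lift_extremal (X Y : G) (v : Hom X Y) (P : D)
    (u : Hom (U X) P) (w : Hom P (U Y)) :
  extremal_decomposition Theta (fmap U v) u w ->
  exists (Q : G) (u' : Hom X Q) (w' : Hom Q Y),
    extremal_decomposition Theta (fmap U v) (fmap U u') (fmap U w').
Proof.
intros E; pose proof E as [[hu dv] ext].
assert (uniq : forall (Z : D) (z : Hom (U X) Z) (s t : Hom Z P), Theta z ->
  w ∘ s = w ∘ t -> s ∘ z = u -> t ∘ z = u -> s = t).
{ intros Z z s t hz e1 e2 e3.
  destruct (ext Z z (w ∘ s)) as [r [_ ur]].
  - split; [exact hz|]; rassoc; rewrite e2; exact dv.
  - transitivity r; [symmetry|]; apply ur; auto. }
assert (hT : Theta (eta M P ∘ u))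
  by (apply (Theta_comp A); [apply (Theta_unit A)|exact hu]).
destruct (ext _ (eta M P ∘ u) (action Y ∘ monad_map w)) as [a [[a1 a2] _]].
{ split; [exact hT|]; rassoc.
  rewrite (comp_reassoc (unit_natural w)); rassoc.
  rewrite (comp_reassoc (action_unit Y)), comp_id_l; exact dv. }
rewrite comp_assoc in a2.
assert (aunit : a ∘ eta M P = idm P).
{ apply (uniq _ u); auto.
  - rewrite (comp_reassoc a1); rassoc; rewrite unit_natural.
    rewrite (comp_reassoc (action_unit Y)), comp_id_l, comp_id_r; auto.
  - apply comp_id_l. }
destruct (lift_algebra (m := M) (P := P) (a := a) aunit) as [Q [i [k [ik hi]]]].
{ change (a ∘ monad_map a = a ∘ action (free M P)).
  apply (uniq _ (eta M _ ∘ (eta M P ∘ u))).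
  - apply (Theta_comp A); [apply (Theta_unit A)|exact hT].
  - apply compatible_assoc, a1.
  - rassoc; rewrite (comp_reassoc (unit_natural a)); rassoc.
    rewrite (comp_reassoc aunit), comp_id_l, comp_assoc; auto.
  - rassoc; rewrite (comp_reassoc (action_unit (free M P))), comp_id_l.
    rewrite comp_assoc; auto. }
change (i ∘ action Q = a ∘ monad_map i) in hi.
assert (au : a ∘ monad_map u = u ∘ action X).
{ apply (uniq _ (eta M (U X))); [apply (Theta_unit A)| | |].
  - rewrite (comp_reassoc a1); rassoc; rewrite <- monad_map_comp, <- dv.
    rewrite comp_assoc, <- dv; symmetry; apply action_natural.
  - rassoc; rewrite unit_natural, comp_assoc; auto.
  - rassoc; rewrite action_unit; apply comp_id_r. }
destruct ik as [ik ki].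
destruct (lift_hom (m := M) (X := X) (Y := Q) (h := k ∘ u)) as [u' hu'].
{ change ((k ∘ u) ∘ action X = action Q ∘ monad_map (k ∘ u)).
  transitivity (k ∘ (i ∘ action Q) ∘ monad_map (k ∘ u)).
  - rewrite hi; rassoc; rewrite <- monad_map_comp, comp_assoc with (h := i).
    rewrite ik, comp_id_l, au; reflexivity.
  - rassoc; rewrite (comp_reassoc ki), comp_id_l; reflexivity. }
destruct (lift_hom (m := M) (X := Q) (Y := Y) (h := w ∘ i)) as [w' hw'].
{ change ((w ∘ i) ∘ action Q = action Y ∘ monad_map (w ∘ i)).
  rassoc; rewrite hi, (comp_reassoc a1); rassoc.
  rewrite monad_map_comp; reflexivity. }
exists Q, u', w'; rewrite hu', hw'.
assert (iku : i ∘ (k ∘ u) = u) by (rewrite (comp_reassoc ik); apply comp_id_l).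
apply (extremal_transport E (j := i) (k := k)); auto.
- split; auto.
- apply (Theta_cancel A) with (g := i); [apply (Theta_iso A (k := k))|].
  + split; auto.
  + rewrite iku; exact hu.
Qed.

(** By uniqueness of extremal decompositions, the given one is isomorphic to one
    lifted from [D], whose image is extremal by construction. *)
Lemma forget_extremal (X Y P : G) (v : Hom X Y) (u : Hom X P) (w : Hom P Y) :
  has_extremal_decompositions Theta -> mono v ->
  extremal_decomposition Psi v u w ->
  extremal_decomposition Theta (fmap U v) (fmap U u) (fmap U w).
Proof.
intros H m E; destruct (H _ _ _ (forget_mono m)) as [P0 [u0 [w0 E0]]].
destruct (lift_extremal E0) as [Q [u' [w' E']]].
destruct (extremal_unique E (reflect_extremal E'))
  as [j [k [[jk kj] [e1 [e2 _]]]]].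
apply (extremal_transport E' (j := fmap U j) (k := fmap U k)).
- split; rewrite <- fmap_comp, ?jk, ?kj; apply fmap_id.
- rewrite <- fmap_comp, e1; reflexivity.
- rewrite <- fmap_comp, e2; reflexivity.
- apply (Psi_iff A), E.
Qed.

(** Maps from [Q] to the underlying object of [X] are maps from the free
    algebra on [Q] to [X], so the pullback of [X] along the unit has the
    universal property required in [D]. *)
Lemma descend_extremal (B C : D) (v : Hom B C) (X : G)
    (u' : Hom (free M B) X) (w' : Hom X (free M C))
    (P : D) (pi : Hom P (U X)) (w : Hom P C) (u : Hom B P) :
  extremal_decomposition Psi (free_map v) u' w' ->
  is_pullback pi w (fmap U w') (eta M C) ->
  pi ∘ u = fmap U u' ∘ eta M B -> w ∘ u = v ->
  extremal_decomposition Theta v u w.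
Proof.
intros [[hu' dv] ext] pb e1 e2; split; [split; auto|].
- apply (Theta_cancel A) with (g := pi).
  + apply (Theta_pullback A pb), (Theta_unit A).
  + rewrite e1; apply (Theta_comp A); [|apply (Theta_unit A)].
    apply (Psi_iff A), hu'.
- intros Q y z [hy dz].
  destruct (ext (free M Q) (free_map y) (free_map z)) as [t [[t1 t2] ut]].
  { split; [apply free_map_Psi, hy|]; rewrite dz; apply free_map_comp. }
  assert (s : fmap U w' ∘ (fmap U t ∘ eta M Q) = eta M C ∘ z).
  { rewrite comp_assoc, <- fmap_comp, t1; apply unit_natural. }
  destruct (pullback_pair pb s) as [r [r1 r2]].
  exists r; split; [split; [exact r2|]|].
  + apply (pullback_joint pb).
    * rw r1; rewrite <- (free_map_unit y).
      rewrite comp_assoc, <- fmap_comp, t2; auto.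
    * rw r2; rewrite e2; auto.
  + intros r' [f1 f2]; apply (pullback_joint pb); [|congruence].
    rewrite r1, <- (transpose_unit M (pi ∘ r')).
    f_equal; f_equal; apply ut; split; apply (transpose_unique (m := M));
      rewrite fmap_comp; rassoc.
    * rewrite transpose_unit, comp_assoc, (proj1 pb); rassoc; rewrite f1.
      symmetry; apply unit_natural.
    * rewrite free_map_unit, (comp_reassoc (transpose_unit M _)); rassoc.
      rewrite f2; exact e1.
Qed.

Lemma unit_pullback_factor (B C : D) (v : Hom B C) (X : G)
    (u' : Hom (free M B) X) (w' : Hom X (free M C))
    (P : D) (pi : Hom P (U X)) (w : Hom P C) :
  free_map v = w' ∘ u' ->
  is_pullback pi w (fmap U w') (eta M C) ->
  exists u : Hom B P, pi ∘ u = fmap U u' ∘ eta M B /\ w ∘ u = v.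
Proof.
intros dv pb; apply (pullback_pair pb).
rewrite comp_assoc, <- fmap_comp, <- dv; apply unit_natural.
Qed.

Theorem extremal_transfer :
  has_extremal_decompositions Theta <-> has_extremal_decompositions Psi.
Proof.
split.
- intros H X Y v m; destruct (H _ _ _ (forget_mono m)) as [P [u [w E]]].
  destruct (lift_extremal E) as [Q [u' [w' E']]].
  exists Q, u', w'; apply reflect_extremal, E'.
- intros H B C v m; destruct (H _ _ _ (free_map_mono m)) as [X [u' [w' E]]].
  destruct (has_pullbacks A (fmap U w') (eta M C)) as [P [pi [w pb]]].
  destruct (unit_pullback_factor (proj2 (proj1 E)) pb) as [u [e1 e2]].
  exists P, u, w; apply (descend_extremal E pb e1 e2).
Qed.

Lemma stability_of_algebras :
  has_extremal_decompositions Theta ->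
  extremal_decompositions_stable Theta -> extremal_decompositions_stable Psi.
Proof.
intros H S X Y P v u w m E Y' t ht X' P' a v' x w' u' pa px e1 e2.
apply reflect_extremal.
apply (S _ _ _ _ _ _ (forget_mono m) (forget_extremal H m E)
         _ (fmap U t) (proj1 (Psi_iff A t) ht)
         _ _ (fmap U a) _ (fmap U x)).
- apply forget_pullback, pa.
- apply forget_pullback, px.
- rewrite <- !fmap_comp, e1; reflexivity.
- rewrite <- fmap_comp, e2; reflexivity.
Qed.

(** The extremal decomposition [P] of [v : B -> C] is the pullback along the
    unit of an extremal decomposition [X] of the free map on [v]. Pulling [X]
    back along the free map on [t] gives an extremal decomposition [X'] of the
    free map on [v'], and the pullback of [P] along [t] is the pullback of [X']
    along the unit, as both are the pullback of [X] along the diagonal of the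
    naturality square of the unit at [t]. *)
Lemma stability_of_base :
  has_extremal_decompositions Psi ->
  extremal_decompositions_stable Psi -> extremal_decompositions_stable Theta.
Proof.
intros H S B C P v u w m E C' t ht B' P' b v' x w' u' pb px e1 e2.
destruct (H _ _ _ (free_map_mono m)) as [X [uX [wX EX]]].
destruct (has_pullbacks A (fmap U wX) (eta M C)) as [P0 [pi0 [w0 pb0]]].
destruct (unit_pullback_factor (proj2 (proj1 EX)) pb0) as [u0 [f1 f2]].
destruct (extremal_unique E (descend_extremal EX pb0 f1 f2))
  as [j [k [jk [g1 [g2 _]]]]].
pose proof (pullback_iso jk pb0) as pbP; rewrite g1 in pbP.
assert (piu : pi0 ∘ j ∘ u = fmap U uX ∘ eta M B)
  by (rassoc; rewrite g2; exact f1).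
set (pi := pi0 ∘ j) in *.
destruct (algebra_pullbacks wX (free_map t)) as [X' [xX [wX' pX]]].
destruct (pullback_pair pX (a := uX ∘ free_map b) (b := free_map v'))
  as [uX' [h1 h2]].
{ rewrite comp_assoc, <- (proj2 (proj1 EX)), <- !free_map_comp, (proj1 pb).
  reflexivity. }
assert (EX' : extremal_decomposition Psi (free_map v') uX' wX').
{ apply (S _ _ _ _ _ _ (free_map_mono m) EX _ _ (free_map_Psi ht)
           _ _ (free_map b) _ xX); auto.
  apply free_map_pullback, pb. }
pose proof (forget_pullback pX) as UpX.
destruct (pullback_pair UpX (a := pi ∘ x) (b := eta M C' ∘ w'))
  as [pi' [k1 k2]].
{ rewrite comp_assoc, (proj1 pbP); rassoc; rewrite (proj1 px).
  rewrite (comp_reassoc (free_map_unit t)); rassoc; reflexivity. }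
apply (descend_extremal EX' (pi := pi')); auto.
- apply (pullback_cancel UpX); [exact k2|].
  rewrite k1, (free_map_unit t); apply (pullback_paste pbP px).
- apply (pullback_joint UpX).
  + rewrite (comp_reassoc k1); rassoc; rewrite e1, (comp_reassoc piu); rassoc.
    rewrite <- (free_map_unit b).
    rewrite !comp_assoc, <- !fmap_comp, h1; reflexivity.
  + rewrite (comp_reassoc k2); rassoc; rewrite e2.
    rewrite comp_assoc, <- fmap_comp, h2; symmetry; apply unit_natural.
Qed.

Theorem stably_extremal_transfer :
  has_stably_extremal_decompositions Theta <->
  has_stably_extremal_decompositions Psi.
Proof.
split; intros [H S]; split;
  [ apply extremal_transfer, H | apply (stability_of_algebras H S)
  | apply extremal_transfer, H | apply (stability_of_base H S) ].
Qed.

End Transfer.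

Section Concrete.
Variable E : Category.
Hypothesis hE : finitely_complete E.

(** Finite completeness only asserts that pullbacks exist; forming free
    groupoids needs a choice of kernel pairs. *)
Record ChosenPullback (A B K : E) (f : Hom A K) (g : Hom B K) := {
  pb_ob : E;
  pb_fst : Hom pb_ob A;
  pb_snd : Hom pb_ob B;
  pb_spec : is_pullback pb_fst pb_snd f g }.

Definition chosen_pullback (A B K : E) (f : Hom A K) (g : Hom B K) :
  ChosenPullback f g.
Proof.
destruct (constructive_indefinite_description _ (pullback_exists f g hE))
  as [P HP].
destruct (constructive_indefinite_description _ HP) as [p Hp].
destruct (constructive_indefinite_description _ Hp) as [q Hq].
exact (Build_ChosenPullback Hq).
Qed.

Definition pair (P A B K : E) (p : Hom P A) (q : Hom P B)
    (f : Hom A K) (g : Hom B K) (pb : is_pullback p q f g)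
    (Z : E) (a : Hom Z A) (b : Hom Z B) (e : f ∘ a = g ∘ b) : Hom Z P :=
  proj1_sig (constructive_indefinite_description _ (pullback_pair pb e)).

Lemma pair_fst (P A B K : E) (p : Hom P A) (q : Hom P B)
    (f : Hom A K) (g : Hom B K) (pb : is_pullback p q f g)
    (Z : E) (a : Hom Z A) (b : Hom Z B) (e : f ∘ a = g ∘ b) :
  p ∘ pair pb e = a.
Proof.
apply (proj2_sig
  (constructive_indefinite_description _ (pullback_pair pb e))).
Qed.

Lemma pair_snd (P A B K : E) (p : Hom P A) (q : Hom P B)
    (f : Hom A K) (g : Hom B K) (pb : is_pullback p q f g)
    (Z : E) (a : Hom Z A) (b : Hom Z B) (e : f ∘ a = g ∘ b) :
  q ∘ pair pb e = b.
Proof.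
apply (proj2_sig
  (constructive_indefinite_description _ (pullback_pair pb e))).
Qed.

(** * The category of points *)

Lemma point_pullback_of_components (P A B K : Pt E)
    (p : PointHom P A) (q : PointHom P B)
    (f : PointHom A K) (g : PointHom B K) :
  is_pullback (htop p) (htop q) (htop f) (htop g) ->
  is_pullback (hbase p) (hbase q) (hbase f) (hbase g) ->
  @is_pullback (Pt E) P A B K p q f g.
Proof.
intros pt pb; apply pullback_intro.
- apply PointHom_eq; [apply pb|apply pt].
- intros Z a b e.
  assert (eb : hbase f ∘ hbase a = hbase g ∘ hbase b)
    by apply (f_equal (@hbase _ _ _) e).
  assert (et : htop f ∘ htop a = htop g ∘ htop b)
    by apply (f_equal (@htop _ _ _) e).
  destruct (pullback_pair pt et) as [t [t1 t2]].
  destruct (pullback_pair pb eb) as [c [c1 c2]].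
  unshelve eexists (Build_PointHom (hbase := c) (htop := t) _ _ : Hom Z P).
  + apply (pullback_joint pb); rewrite !comp_assoc, <- hepi, ?c1, ?c2;
      rassoc; rewrite ?t1, ?t2; apply hepi.
  + apply (pullback_joint pt); rewrite !comp_assoc, hsec, ?t1, ?t2;
      rassoc; rewrite ?c1, ?c2; apply hsec.
  + split; apply PointHom_eq; assumption.
- intros Z u v e1 e2; apply PointHom_eq.
  + apply (pullback_joint pb);
      [apply (f_equal (@hbase _ _ _) e1)|apply (f_equal (@hbase _ _ _) e2)].
  + apply (pullback_joint pt);
      [apply (f_equal (@htop _ _ _) e1)|apply (f_equal (@htop _ _ _) e2)].
Qed.

Lemma point_pullback_exists (A B K : Pt E) (f : Hom A K) (g : Hom B K) :
  exists (P : Pt E) (p : PointHom P A) (q : PointHom P B),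
    is_pullback (htop p) (htop q) (htop f) (htop g) /\
    is_pullback (hbase p) (hbase q) (hbase f) (hbase g).
Proof.
destruct (chosen_pullback (htop f) (htop g)) as [T t1 t2 ht].
destruct (chosen_pullback (hbase f) (hbase g)) as [Y y1 y2 hy].
destruct (pullback_pair hy (a := pepi A ∘ t1) (b := pepi B ∘ t2))
  as [c [c1 c2]].
{ rewrite !comp_assoc, <- !hepi; rassoc; rewrite (proj1 ht); reflexivity. }
destruct (pullback_pair ht (a := psec A ∘ y1) (b := psec B ∘ y2))
  as [s [s1 s2]].
{ rewrite !comp_assoc, !hsec; rassoc; rewrite (proj1 hy); reflexivity. }
assert (cs : c ∘ s = idm Y).
{ apply (pullback_joint hy).
  - rw c1; rewrite s1; rw (psplit A); rewrite comp_id_l, comp_id_r; auto.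
  - rw c2; rewrite s2; rw (psplit B); rewrite comp_id_l, comp_id_r; auto. }
exists (Build_Point cs).
unshelve eexists (Build_PointHom (P := Build_Point cs)
  (hbase := y1) (htop := t1) _ _); auto.
unshelve eexists (Build_PointHom (P := Build_Point cs)
  (hbase := y2) (htop := t2) _ _); auto.
Qed.

(** Pullbacks of points can be computed componentwise, and any other pullback is
    isomorphic to one of these. *)
Lemma point_pullback_components (P A B K : Pt E)
    (p : Hom P A) (q : Hom P B) (f : Hom A K) (g : Hom B K) :
  is_pullback p q f g ->
  is_pullback (htop p) (htop q) (htop f) (htop g) /\
  is_pullback (hbase p) (hbase q) (hbase f) (hbase g).
Proof.
intros pb; destruct (point_pullback_exists f g) as [Q [p' [q' [ht hb]]]].
destruct (pullback_unique pb (point_pullback_of_components ht hb))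
  as [j [k [[jk kj] [<- <-]]]].
split.
- apply (pullback_iso (j := htop j) (k := htop k)); auto.
  split; [apply (f_equal (@htop _ _ _) jk)|apply (f_equal (@htop _ _ _) kj)].
- apply (pullback_iso (j := hbase j) (k := hbase k)); auto.
  split; [apply (f_equal (@hbase _ _ _) jk)|apply (f_equal (@hbase _ _ _) kj)].
Qed.

(** The pullback [W] of [pepi Q] along [hbase h] is again a point, over the base
    of [P], so a cartesian [h] can be compared with it. *)
Lemma cartesian_iff_pullback (P Q : Pt E) (h : Hom P Q) :
  cartesian (PtBase E) h <->
  is_pullback (htop h) (pepi P) (pepi Q) (hbase h).
Proof.
split.
- intros c; destruct (chosen_pullback (pepi Q) (hbase h)) as [W a b hW].
  destruct (pullback_pair hW (a := psec Q ∘ hbase h) (b := idm _))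
    as [s [s1 s2]].
  { rw (psplit Q); rewrite comp_id_l, comp_id_r; reflexivity. }
  pose (R := Build_Point s2 : Pt E).
  unshelve epose (psi := Build_PointHom (P := R) (Q := Q)
    (hbase := hbase h) (htop := a) _ _ : Hom R Q); [apply hW|exact s1|].
  destruct (c R psi (idm (pbase P))) as [x [[x1 x2] _]];
    [apply comp_id_r|].
  apply (f_equal (@htop _ _ _)) in x1; cbn in x1, x2.
  pose proof (hepi x) as x3; cbn in x3; rewrite x2, comp_id_l in x3.
  destruct (pullback_pair hW (hepi h)) as [d [h1 h2]].
  (* The comparison [d] with the pullback [W] is invertible, by uniqueness of
     cartesian factorizations. *)
  unshelve epose (y := Build_PointHom (P := P) (Q := R)
    (hbase := idm (pbase P)) (htop := d) _ _ : Hom P R).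
  { cbn; rewrite h2, comp_id_l; reflexivity. }
  { cbn; rewrite comp_id_r; apply (pullback_joint hW).
    - rw h1; rewrite s1; apply hsec.
    - rw h2; rewrite s2; apply psplit. }
  assert (xd : htop x ∘ d = idm (ptop P)).
  { destruct (c P h (idm (pbase P))) as [z [_ uz]]; [apply comp_id_r|].
    assert (e : x ∘ y = idm P).
    { transitivity z; [symmetry|]; apply uz; split.
      - apply PointHom_eq; cbn.
        + rewrite x2, !comp_id_r; reflexivity.
        + rw x1; exact h1.
      - cbn; rewrite x2; apply comp_id_l.
      - apply comp_id_r.
      - reflexivity. }
    apply (f_equal (@htop _ _ _) e). }
  rewrite <- h1, <- h2.
  apply (pullback_iso (j := d) (k := htop x)); [split|]; auto.
  apply (pullback_joint hW); rewrite comp_id_r.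
  + rw h1; exact x1.
  + rw h2; exact x3.
- intros pb Z psi g e; cbn in g, e.
  destruct (pullback_pair pb (a := htop psi) (b := g ∘ pepi Z))
    as [t [t1 t2]].
  { rewrite hepi, <- e; rassoc; reflexivity. }
  unshelve eexists (Build_PointHom (hbase := g) (htop := t) _ _ : Hom Z P).
  + exact t2.
  + apply (pullback_joint pb).
    * rw t1; rewrite hsec, <- e; rewrite (comp_reassoc (hsec h)); rassoc; auto.
    * rw t2; rewrite psplit; rw (psplit P).
      rewrite comp_id_l, comp_id_r; reflexivity.
  + split; [split; [apply PointHom_eq|]; auto|].
    intros x [e1 e2]; apply PointHom_eq; cbn in *; [auto|].
    apply (pullback_joint pb).
    * rewrite t1, <- e1; reflexivity.
    * rewrite t2, <- e2; symmetry; apply hepi.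
Qed.

(** * Composition of generalized arrows *)

Lemma composite_precomp (X1 X2 : E) (p q m : Hom X2 X1)
    (Z Z' : E) (a b c : Hom Z X1) (z : Hom Z' Z) :
  is_composite p q m a b c -> is_composite p q m (a ∘ z) (b ∘ z) (c ∘ z).
Proof.
intros [k [k1 [k2 k3]]]; exists (k ∘ z).
rewrite !comp_assoc, k1, k2, k3; auto.
Qed.

Lemma composite_exists (X1 X2 K : E) (p q m : Hom X2 X1) (f g : Hom X1 K)
    (pb : is_pullback p q f g) (Z : E) (a b : Hom Z X1) :
  f ∘ a = g ∘ b -> exists c, is_composite p q m a b c.
Proof.
intros e; destruct (pullback_pair pb e) as [k [k1 k2]].
exists (m ∘ k), k; auto.
Qed.

Lemma composite_unique (X1 X2 K : E) (p q m : Hom X2 X1) (f g : Hom X1 K)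
    (pb : is_pullback p q f g) (Z : E) (a b c c' : Hom Z X1) :
  is_composite p q m a b c -> is_composite p q m a b c' -> c = c'.
Proof.
intros [k [k1 [k2 <-]]] [l [l1 [l2 <-]]]; f_equal.
apply (pullback_joint pb); congruence.
Qed.

Section GroupoidArrows.
Variable X : Groupoid E.

Definition composes (Z : E) (a b c : Hom Z (gar X)) : Prop :=
  is_composite p0 p1 gm a b c.

Lemma composes_precomp (Z Z' : E) (a b c : Hom Z (gar X)) (z : Hom Z' Z) :
  composes a b c -> composes (a ∘ z) (b ∘ z) (c ∘ z).
Proof. apply composite_precomp. Qed.

Lemma composes_exists (Z : E) (a b : Hom Z (gar X)) :
  d1 ∘ a = d0 ∘ b -> exists c, composes a b c.
Proof. apply (composite_exists gm (gpairs_pullback X)). Qed.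

Lemma composes_unique (Z : E) (a b c c' : Hom Z (gar X)) :
  composes a b c -> composes a b c' -> c = c'.
Proof. apply (composite_unique (gpairs_pullback X)). Qed.

Lemma composes_composable (Z : E) (a b c : Hom Z (gar X)) :
  composes a b c -> d1 ∘ a = d0 ∘ b.
Proof.
intros [k [<- [<- _]]]; rewrite !comp_assoc, (proj1 (gpairs_pullback X)); auto.
Qed.

Lemma composes_d0 (Z : E) (a b c : Hom Z (gar X)) :
  composes a b c -> d0 ∘ c = d0 ∘ a.
Proof. intros [k [<- [_ <-]]]; rewrite !comp_assoc, d0_gm; auto. Qed.

Lemma composes_d1 (Z : E) (a b c : Hom Z (gar X)) :
  composes a b c -> d1 ∘ c = d1 ∘ b.
Proof. intros [k [_ [<- <-]]]; rewrite !comp_assoc, d1_gm; auto. Qed.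

Lemma composes_id_l (Z : E) (a : Hom Z (gar X)) :
  composes (s0 ∘ (d0 ∘ a)) a a.
Proof.
pose proof (composes_precomp a (gm_id_l X)) as H.
rewrite comp_id_l, <- comp_assoc in H; exact H.
Qed.

Lemma composes_id_r (Z : E) (a : Hom Z (gar X)) :
  composes a (s0 ∘ (d1 ∘ a)) a.
Proof.
pose proof (composes_precomp a (gm_id_r X)) as H.
rewrite comp_id_l, <- comp_assoc in H; exact H.
Qed.

Lemma composes_inv_l (Z : E) (a : Hom Z (gar X)) :
  composes (ginv ∘ a) a (s0 ∘ (d1 ∘ a)).
Proof.
pose proof (composes_precomp a (gm_inv_l X)) as H.
rewrite comp_id_l, <- comp_assoc in H; exact H.
Qed.

Lemma composes_inv_r (Z : E) (a : Hom Z (gar X)) :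
  composes a (ginv ∘ a) (s0 ∘ (d0 ∘ a)).
Proof.
pose proof (composes_precomp a (gm_inv_r X)) as H.
rewrite comp_id_l, <- comp_assoc in H; exact H.
Qed.

Lemma composes_cancel (Z : E) (a b b' c : Hom Z (gar X)) :
  composes a b c -> composes a b' c -> b = b'.
Proof.
assert (H : forall b : Hom Z (gar X),
  composes a b c -> composes (ginv ∘ a) c b).
{ clear; intros b h; apply (gm_assoc (composes_inv_l a) h).
  rewrite (composes_composable h); apply composes_id_l. }
intros h h'; apply (composes_unique (H _ h) (H _ h')).
Qed.

Lemma composes_divide (Z : E) (a b : Hom Z (gar X)) :
  d0 ∘ a = d0 ∘ b -> exists c, composes a c b.
Proof.
intros e; destruct (composes_exists (a := ginv ∘ a) (b := b)) as [c hc].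
- rewrite comp_assoc, d1_ginv; exact e.
- exists c; apply (gm_assoc (composes_inv_r a) hc).
  rewrite e; apply composes_id_l.
Qed.

Lemma composes_id_unique (Z : E) (a b : Hom Z (gar X)) :
  composes a b a -> b = s0 ∘ (d1 ∘ a).
Proof. intros h; apply (composes_cancel h (composes_id_r a)). Qed.

Lemma composes_id_unique_l (Z : E) (x : Hom Z (gob X)) (b c : Hom Z (gar X)) :
  composes (s0 ∘ x) b c -> b = c.
Proof.
intros h; pose proof (composes_composable h) as e.
rewrite comp_assoc, d1_s0, comp_id_l in e; subst x.
apply (composes_unique (composes_id_l b) h).
Qed.

End GroupoidArrows.

Lemma functor_composes (X Y : Groupoid E) (k : GroupoidHom X Y)
    (Z : E) (a b c : Hom Z (gar X)) :
  composes a b c -> composes (f1 k ∘ a) (f1 k ∘ b) (f1 k ∘ c).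
Proof.
intros [z [<- [<- <-]]]; rewrite !comp_assoc.
apply composes_precomp, f_gm.
Qed.

Lemma preserves_gm (X Y : Groupoid E) (h : Hom (gar X) (gar Y)) :
  (forall (Z : E) (a b c : Hom Z (gar X)),
    composes a b c -> composes (X := Y) (h ∘ a) (h ∘ b) (h ∘ c)) ->
  is_composite (@p0 E Y) p1 gm (h ∘ p0) (h ∘ p1) (h ∘ gm).
Proof. intros H; apply H; exists (idm _); rewrite !comp_id_r; auto. Qed.

(** * Groupoids from divisions *)

Definition KP (P : Point E) := chosen_pullback (pepi P) (pepi P).
Definition kp (P : Point E) : E := pb_ob (KP P).
Definition r0 {P : Point E} : Hom (kp P) (ptop P) := pb_fst (KP P).
Definition r1 {P : Point E} : Hom (kp P) (ptop P) := pb_snd (KP P).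

Lemma kp_pullback (P : Point E) :
  is_pullback (@r0 P) (@r1 P) (pepi P) (pepi P).
Proof. apply pb_spec. Qed.

(** A groupoid can be presented by the division [a^-1 b] of arrows with the same
    source instead of by composition and inversion; this is the form in which
    algebras for the kernel pair monad come. The graph [divides a b c], for
    [c = a^-1 b], is written with [is_composite], so that the lemmas on
    generalized composites apply. The last law says that
    [(a^-1 b)^-1 (a^-1 c) = b^-1 c]. *)
Record Division (P : Point E) := {
  target : Hom (ptop P) (pbase P);
  div : Hom (kp P) (ptop P);
  divides : forall Z : E, Hom Z (ptop P) -> Hom Z (ptop P) ->
    Hom Z (ptop P) -> Prop := fun Z a b c => is_composite r0 r1 div a b c;
  target_sec : target ∘ psec P = idm (pbase P);
  epi_div : pepi P ∘ div = target ∘ r0;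
  target_div : target ∘ div = target ∘ r1;
  div_sec : divides (psec P ∘ pepi P) (idm _) (idm _);
  div_diag : divides (idm _) (idm _) (psec P ∘ target);
  div_div : forall (Z : E) (a b c x y z : Hom Z (ptop P)),
    divides a b x -> divides a c y -> divides b c z -> divides x y z }.

Section GroupoidOfDivision.
Variables (P : Point E) (V : Division P).

Notation dv := (divides V).

Lemma divides_precomp (Z Z' : E) (a b c : Hom Z (ptop P)) (z : Hom Z' Z) :
  dv a b c -> dv (a ∘ z) (b ∘ z) (c ∘ z).
Proof. apply composite_precomp. Qed.

Lemma divides_exists (Z : E) (a b : Hom Z (ptop P)) :
  pepi P ∘ a = pepi P ∘ b -> exists c, dv a b c.
Proof. apply (composite_exists _ (kp_pullback P)). Qed.

Lemma divides_unique (Z : E) (a b c c' : Hom Z (ptop P)) :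
  dv a b c -> dv a b c' -> c = c'.
Proof. apply (composite_unique (kp_pullback P)). Qed.

Lemma divides_epi (Z : E) (a b c : Hom Z (ptop P)) :
  dv a b c -> pepi P ∘ a = pepi P ∘ b.
Proof.
intros [k [<- [<- _]]]; rewrite !comp_assoc, (proj1 (kp_pullback P)); auto.
Qed.

Lemma divides_source (Z : E) (a b c : Hom Z (ptop P)) :
  dv a b c -> pepi P ∘ c = target V ∘ a.
Proof. intros [k [<- [_ <-]]]; rewrite !comp_assoc, epi_div; auto. Qed.

Lemma divides_target (Z : E) (a b c : Hom Z (ptop P)) :
  dv a b c -> target V ∘ c = target V ∘ b.
Proof. intros [k [_ [<- <-]]]; rewrite !comp_assoc, target_div; auto. Qed.

Lemma divides_sec (Z : E) (a : Hom Z (ptop P)) :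
  dv (psec P ∘ (pepi P ∘ a)) a a.
Proof.
pose proof (divides_precomp a (div_sec V)) as H.
rewrite comp_id_l, <- comp_assoc in H; exact H.
Qed.

Lemma divides_cancel (Z : E) (a b b' c : Hom Z (ptop P)) :
  dv a b c -> dv a b' c -> b = b'.
Proof.
intros h h'.
destruct (divides_exists (a := a) (b := psec P ∘ (pepi P ∘ a))) as [i hi].
{ rewrite comp_assoc, psplit, comp_id_l; reflexivity. }
assert (H : forall x : Hom Z (ptop P), dv a x c -> dv i c x).
{ intros x hx; apply (div_div hi hx).
  rewrite (divides_epi hx); apply divides_sec. }
apply (divides_unique (H _ h) (H _ h')).
Qed.

Lemma epi_sec_epi : pepi P ∘ idm _ = pepi P ∘ (psec P ∘ pepi P).
Proof. rw (psplit P); rewrite comp_id_l, comp_id_r; reflexivity. Qed.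

Definition div_inv : Hom (ptop P) (ptop P) :=
  div V ∘ pair (kp_pullback P) epi_sec_epi.

Lemma div_inv_spec (Z : E) (a : Hom Z (ptop P)) :
  dv a (psec P ∘ (pepi P ∘ a)) (div_inv ∘ a).
Proof.
assert (H : dv (idm _) (psec P ∘ pepi P) div_inv).
{ exists (pair (kp_pullback P) epi_sec_epi).
  rewrite pair_fst, pair_snd; auto. }
apply (divides_precomp a) in H; rewrite comp_id_l, <- comp_assoc in H.
exact H.
Qed.

Definition composable := chosen_pullback (target V) (pepi P).
Notation q0 := (pb_fst composable).
Notation q1 := (pb_snd composable).

Lemma inv_composable : pepi P ∘ (div_inv ∘ q0) = pepi P ∘ q1.
Proof.
rewrite (divides_source (div_inv_spec q0)); apply (pb_spec composable).
Qed.

Definition div_mult : Hom (pb_ob composable) (ptop P) :=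
  div V ∘ pair (kp_pullback P) inv_composable.

(** The product [a c] is defined as [(a^-1)^-1 c]; that the equation [a c = b]
    amounts to [c = a^-1 b] is a consequence of the laws of a division, and all
    the axioms of a groupoid are checked through it. *)
Lemma div_mult_iff (Z : E) (a b c : Hom Z (ptop P)) :
  is_composite q0 q1 div_mult a c b <-> dv a b c.
Proof.
assert (H : forall (Z : E) (a b c : Hom Z (ptop P)),
  dv a b c -> dv (div_inv ∘ a) c b).
{ clear; intros Z a b c h; apply (div_div (div_inv_spec a) h).
  rewrite (divides_epi h); apply divides_sec. }
assert (K : dv (div_inv ∘ q0) q1 div_mult).
{ exists (pair (kp_pullback P) inv_composable).
  rewrite pair_fst, pair_snd; auto. }
split.
- intros [k [<- [<- <-]]].
  pose proof (divides_precomp k K) as K'; rewrite <- comp_assoc in K'.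
  set (a := q0 ∘ k) in *; set (c := q1 ∘ k) in *; set (b := div_mult ∘ k) in *.
  assert (e : pepi P ∘ a = pepi P ∘ b).
  { rewrite (divides_source K'), (divides_target (div_inv_spec a)).
    rewrite (comp_assoc (target V)), target_sec, comp_id_l; reflexivity. }
  destruct (divides_exists e) as [d hd].
  rewrite (divides_cancel K' (H _ _ _ _ hd)) at 1; exact hd.
- intros h; destruct (pullback_pair (pb_spec composable) (a := a) (b := c))
    as [k [k1 k2]].
  { symmetry; apply (divides_source h). }
  exists k; split; [exact k1|split; [exact k2|]].
  apply (divides_precomp k) in K; rewrite <- comp_assoc, k1, k2 in K.
  apply (divides_unique K (H _ _ _ _ h)).
Qed.

Definition groupoid_of_division : Groupoid E.
Proof.
refine {| gob := pbase P; gar := ptop P; gpairs := pb_ob composable;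
  d0 := pepi P; d1 := target V; s0 := psec P;
  p0 := q0; p1 := q1; gm := div_mult; ginv := div_inv;
  gpairs_pullback := pb_spec composable;
  d0_s0 := psplit P; d1_s0 := target_sec V |}.
- symmetry; apply (divides_epi (c := q1)), div_mult_iff.
  exists (idm _); rewrite !comp_id_r; auto.
- symmetry; apply (divides_target (a := q0)), div_mult_iff.
  exists (idm _); rewrite !comp_id_r; auto.
- apply div_mult_iff, div_sec.
- apply div_mult_iff, div_diag.
- intros Z a b c ab bc abc; rewrite !div_mult_iff; intros h1 h2 h3.
  destruct (divides_exists (a := a) (b := abc)) as [y hy].
  { rewrite (divides_epi h1); apply (divides_epi h3). }
  pose proof (div_div h1 hy h3) as h4.
  rewrite <- (divides_cancel h4 h2); exact hy.
- rewrite <- (comp_id_r div_inv), (divides_source (div_inv_spec (idm _))).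
  apply comp_id_r.
- rewrite <- (comp_id_r div_inv), (divides_target (div_inv_spec (idm _))).
  rewrite comp_id_r; rw (target_sec V); apply comp_id_l.
- apply div_mult_iff.
  pose proof (div_inv_spec (idm _)) as h; rewrite !comp_id_r in h; exact h.
- apply div_mult_iff.
  pose proof (div_inv_spec (idm _)) as h; rewrite !comp_id_r in h.
  apply (div_div h (div_diag V) (div_sec V)).
Defined.

Lemma groupoid_of_division_composes (Z : E) (a b c : Hom Z (ptop P)) :
  composes (X := groupoid_of_division) a c b <-> dv a b c.
Proof. apply div_mult_iff. Qed.

End GroupoidOfDivision.

(** * Groupoids are monadic over points *)

Definition source_point (X : Groupoid E) : Point E := Build_Point (d0_s0 X).

Definition source_map (X Y : Groupoid E) (k : GroupoidHom X Y) :
  PointHom (source_point X) (source_point Y) :=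
  @Build_PointHom E (source_point X) (source_point Y)
    (f0 k) (f1 k) (f_d0 k) (f_s0 k).

Definition Source : Functor (Grd E) (Pt E).
Proof.
refine {| fob := source_point : Grd E -> Pt E; fmap := source_map |}.
- intros X; apply PointHom_eq; reflexivity.
- intros X Y Z g f; apply PointHom_eq; reflexivity.
Defined.

Lemma diagonal_epi (P : Point E) : pepi P ∘ idm _ = pepi P ∘ idm _.
Proof. reflexivity. Qed.

Definition kp_point (P : Point E) : Point E :=
  @Build_Point E (kp P) (ptop P) r0 (pair (kp_pullback P) (diagonal_epi P))
    (pair_fst _ _).

Lemma kp_sec_r0 (P : Point E) : r0 ∘ psec (kp_point P) = idm (ptop P).
Proof. apply pair_fst. Qed.

Lemma kp_sec_r1 (P : Point E) : r1 ∘ psec (kp_point P) = idm (ptop P).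
Proof. apply pair_snd. Qed.

Lemma kp_epi (P : Point E) (Z : E) (a : Hom Z (kp P)) :
  pepi P ∘ (r0 ∘ a) = pepi P ∘ (r1 ∘ a).
Proof. rewrite !comp_assoc, (proj1 (kp_pullback P)); reflexivity. Qed.

Lemma kp_joint (P : Point E) (Z : E) (a b : Hom Z (kp P)) :
  r0 ∘ a = r0 ∘ b -> r1 ∘ a = r1 ∘ b -> a = b.
Proof. apply (pullback_joint (kp_pullback P)). Qed.

Lemma kp_point_square (P : Point E) :
  @r0 P ∘ @r0 (kp_point P) = @r0 P ∘ @r1 (kp_point P).
Proof. apply (kp_pullback (kp_point P)). Qed.

Lemma kp_div_epi (P : Point E) :
  pepi P ∘ (r1 ∘ @r0 (kp_point P)) = pepi P ∘ (r1 ∘ @r1 (kp_point P)).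
Proof.
rewrite <- !kp_epi, kp_point_square; reflexivity.
Qed.

(** The quotient of the pairs [(x, y)] and [(x, z)] is [(y, z)]. *)
Definition kp_div (P : Point E) : Hom (kp (kp_point P)) (kp P) :=
  pair (kp_pullback P) (kp_div_epi P).

Lemma kp_divides (P : Point E) (Z : E) (a b c : Hom Z (kp P)) :
  is_composite r0 r1 (kp_div P) a b c <->
  r0 ∘ a = r0 ∘ b /\ r0 ∘ c = r1 ∘ a /\ r1 ∘ c = r1 ∘ b.
Proof.
split.
- intros [k [<- [<- <-]]]; unfold kp_div.
  rewrite !(comp_assoc _ (pair _ _)), pair_fst, pair_snd; rassoc; split; auto.
  rewrite !comp_assoc, kp_point_square; reflexivity.
- intros [h1 [h2 h3]].
  destruct (pullback_pair (kp_pullback (kp_point P)) h1) as [k [k1 k2]].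
  change (ptop (kp_point P)) with (kp P) in *.
  exists k; repeat split; auto; unfold kp_div; apply kp_joint.
  + rewrite comp_assoc, pair_fst; rassoc; rewrite k1; auto.
  + rewrite comp_assoc, pair_snd; rassoc; rewrite k2; auto.
Qed.

Definition kp_division (P : Point E) : Division (kp_point P).
Proof.
refine {| target := r1 : Hom (ptop (kp_point P)) (pbase (kp_point P));
          div := kp_div P |}.
- apply kp_sec_r1.
- apply pair_fst.
- apply pair_snd.
- apply kp_divides; rewrite !comp_id_r; split; [|split; auto].
  + rewrite comp_assoc, kp_sec_r0; apply comp_id_l.
  + rewrite comp_assoc, kp_sec_r1; symmetry; apply comp_id_l.
- apply kp_divides; rewrite !comp_id_r; split; [|split]; auto.
  + rewrite comp_assoc, kp_sec_r0; apply comp_id_l.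
  + rewrite comp_assoc, kp_sec_r1; apply comp_id_l.
- intros Z a b c x y z; rewrite !kp_divides.
  intros [e1 [e2 e3]] [e4 [e5 e6]] [e7 [e8 e9]].
  repeat split; congruence.
Defined.

(** The kernel pair of the point as an equivalence relation, indiscrete on each
    fibre; a functor out of it is determined by its values on the pairs
    [(s f x, x)]. *)
Definition free_groupoid (P : Point E) : Groupoid E :=
  groupoid_of_division (kp_division P).

Lemma free_composes (P : Point E) (Z : E) (a b c : Hom Z (kp P)) :
  composes (X := free_groupoid P) a b c <->
  r1 ∘ a = r0 ∘ b /\ r0 ∘ c = r0 ∘ a /\ r1 ∘ c = r1 ∘ b.
Proof.
transitivity (r0 ∘ a = r0 ∘ c /\ r0 ∘ b = r1 ∘ a /\ r1 ∘ b = r1 ∘ c).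
- etransitivity; [apply groupoid_of_division_composes|apply kp_divides].
- intuition congruence.
Qed.

Lemma sec_epi_epi (P : Point E) :
  pepi P ∘ (psec P ∘ pepi P) = pepi P ∘ idm _.
Proof. symmetry; apply epi_sec_epi. Qed.

Definition based_pair (P : Point E) : Hom (ptop P) (kp P) :=
  pair (kp_pullback P) (sec_epi_epi P).

Lemma based_pair_r0 (P : Point E) : r0 ∘ based_pair P = psec P ∘ pepi P.
Proof. apply pair_fst. Qed.

Lemma based_pair_r1 (P : Point E) : r1 ∘ based_pair P = idm _.
Proof. apply pair_snd. Qed.

Definition point_unit (P : Point E) :
  PointHom P (source_point (free_groupoid P)).
Proof.
refine (@Build_PointHom E P (source_point (free_groupoid P))
  (psec P) (based_pair P) (based_pair_r0 P) _).
apply kp_joint.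
- rewrite comp_assoc, based_pair_r0; rassoc.
  rewrite psplit, (comp_reassoc (kp_sec_r0 P)), comp_id_l, comp_id_r; auto.
- rewrite comp_assoc, based_pair_r1; rassoc.
  rewrite (comp_reassoc (kp_sec_r1 P)), !comp_id_l; auto.
Defined.

Section Transpose.
Variables (P : Point E) (X : Groupoid E).

(** A map of points sends [a] to an arrow issuing from the image of the base
    point of its fibre; the pair [(a, b)] has to go to the quotient of the
    arrows assigned to [a] and [b]. *)
Definition is_transpose (h : PointHom P (source_point X))
    (k : GroupoidHom (free_groupoid P) X) : Prop :=
  f0 k = d1 ∘ htop h /\
  composes (X := X) (htop h ∘ r0) (f1 k) (htop h ∘ r1).

Lemma transpose_exists (h : PointHom P (source_point X)) :
  exists k, is_transpose h k.
Proof.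
pose proof (hepi h) as he; pose proof (hsec h) as hs; cbn in he, hs.
destruct (composes_divide (X := X) (a := htop h ∘ r0) (b := htop h ∘ r1))
  as [k1 hk].
{ cbn; rw he; rewrite (comp_reassoc he); rassoc.
  rewrite (proj1 (kp_pullback P)); reflexivity. }
unshelve eexists (@Build_GroupoidHom E (free_groupoid P) X
  (d1 ∘ htop h) k1 _ _ _ _).
- change (d0 ∘ k1 = d1 ∘ htop h ∘ @r0 P).
  rewrite <- (composes_composable hk); rassoc; reflexivity.
- change (d1 ∘ k1 = d1 ∘ htop h ∘ @r1 P).
  rewrite <- (composes_d1 hk); rassoc; reflexivity.
- change (k1 ∘ psec (kp_point P) = s0 ∘ (d1 ∘ htop h)).
  apply (composes_precomp (psec (kp_point P))) in hk.
  revert hk; rassoc; rewrite kp_sec_r0, kp_sec_r1, comp_id_r.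
  apply composes_id_unique.
- apply (preserves_gm (X := free_groupoid P)); intros Z a b c C.
  apply free_composes in C; destruct C as [c1 [c2 c3]].
  cbn in a, b, c; change (composes (X := X) (k1 ∘ a) (k1 ∘ b) (k1 ∘ c)).
  pose proof (composes_precomp a hk) as ea.
  pose proof (composes_precomp b hk) as eb.
  pose proof (composes_precomp c hk) as ec.
  rewrite <- !comp_assoc in ea, eb, ec.
  rewrite c2, c3 in ec; rewrite <- c1 in eb.
  assert (d : d1 ∘ (k1 ∘ a) = d0 ∘ (k1 ∘ b)).
  { rewrite <- (composes_d1 ea); apply (composes_composable eb). }
  destruct (composes_exists d) as [x hx].
  rewrite <- (composes_cancel (gm_assoc ea hx eb) ec); exact hx.
- split; [reflexivity|exact hk].
Qed.

Definition point_transpose (h : PointHom P (source_point X)) :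
  GroupoidHom (free_groupoid P) X :=
  proj1_sig (constructive_indefinite_description _ (transpose_exists h)).

Lemma point_transpose_spec (h : PointHom P (source_point X)) :
  is_transpose h (point_transpose h).
Proof.
apply (proj2_sig (constructive_indefinite_description _ (transpose_exists h))).
Qed.

Lemma is_transpose_unit (h : PointHom P (source_point X)) k :
  is_transpose h k ->
  Point_comp (source_map k) (point_unit P) = h.
Proof.
intros [e0 e1]; pose proof (hepi h) as he; pose proof (hsec h) as hs.
cbn in he, hs; apply PointHom_eq; cbn.
- rewrite e0; rassoc; rewrite hs, comp_assoc, d1_s0; apply comp_id_l.
- apply (composes_precomp (based_pair P)) in e1; revert e1; rassoc.
  rewrite based_pair_r0, based_pair_r1, comp_id_r.
  cbn; rewrite (comp_reassoc hs); rassoc.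
  apply composes_id_unique_l.
Qed.

Lemma unit_is_transpose (k : GroupoidHom (free_groupoid P) X) :
  is_transpose (Point_comp (source_map k) (point_unit P)) k.
Proof.
pose proof (f_d1 k) as h1; cbn in h1; split; cbn.
- rewrite comp_assoc, h1; rassoc.
  rewrite based_pair_r1, comp_id_r; reflexivity.
- assert (C : composes (X := free_groupoid P)
      (based_pair P ∘ r0) (idm (kp P)) (based_pair P ∘ r1)).
  { apply free_composes; rewrite !comp_id_r, !comp_assoc.
    rewrite !based_pair_r0, !based_pair_r1, !comp_id_l; rassoc.
    rewrite (proj1 (kp_pullback P)); auto. }
  apply (functor_composes k) in C; cbn in C.
  rewrite comp_id_r in C; rassoc; exact C.
Qed.

Lemma is_transpose_unique (h : PointHom P (source_point X)) k k' :
  is_transpose h k -> is_transpose h k' -> k = k'.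
Proof.
intros [e0 e1] [e0' e1']; apply GroupoidHom_eq; [congruence|].
apply (composes_cancel e1 e1').
Qed.

End Transpose.

Lemma point_action (X : Groupoid E) :
  let k := point_transpose (Point_id (source_point X)) in
  f0 k = @d1 E X /\
  composes (X := X) (@r0 (source_point X)) (f1 k) (@r1 (source_point X)).
Proof.
destruct (point_transpose_spec (Point_id (source_point X))) as [e0 e1].
cbn in e0, e1; rewrite comp_id_r in e0; rewrite !comp_id_l in e1; auto.
Qed.

Definition point_free_map (P Q : Point E) (h : PointHom P Q) :
  GroupoidHom (free_groupoid P) (free_groupoid Q) :=
  point_transpose (Point_comp (point_unit Q) h).

Lemma point_free_map_spec (P Q : Point E) (h : PointHom P Q) :
  f0 (point_free_map h) = htop h /\
  @r0 Q ∘ f1 (point_free_map h) = htop h ∘ r0 /\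
  @r1 Q ∘ f1 (point_free_map h) = htop h ∘ r1.
Proof.
destruct (point_transpose_spec (Point_comp (point_unit Q) h))
  as [e0 _].
fold (point_free_map h) in e0; cbn in e0.
rewrite comp_assoc, based_pair_r1, comp_id_l in e0.
split; [exact e0|].
pose proof (f_d0 (point_free_map h)) as h0.
pose proof (f_d1 (point_free_map h)) as h1.
rewrite e0 in h0, h1; auto.
Qed.

(** Compatibility with the actions is compatibility with division, hence with
    composition. *)
Lemma point_lift_hom (X Y : Groupoid E)
    (h : PointHom (source_point X) (source_point Y)) :
  Point_comp h (source_map (point_transpose (Point_id (source_point X))))
  = Point_comp (source_map (point_transpose (Point_id (source_point Y))))
      (source_map (point_free_map h)) ->
  exists k : GroupoidHom X Y, source_map k = h.
Proof.
intros e.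
destruct (point_action X) as [x0 x1], (point_action Y) as [y0 y1].
destruct (point_free_map_spec h) as [h0 [h1 h2]].
pose proof (f_equal (@hbase _ _ _) e) as eb.
pose proof (f_equal (@htop _ _ _) e) as et.
clear e; cbn in eb, et.
unshelve eexists (@Build_GroupoidHom E X Y (hbase h) (htop h) _ _ _ _).
- apply (hepi h).
- rewrite <- x0, <- y0, eb, h0; reflexivity.
- apply (hsec h).
- apply preserves_gm; intros Z u v w C.
  destruct (pullback_pair (kp_pullback (source_point X))
    (eq_sym (composes_d0 C))) as [k [k1 k2]].
  apply (composes_precomp k) in x1.
  apply (composes_precomp (f1 (point_free_map h) ∘ k)) in y1.
  cbn in x1, y1, k1, k2, h1, h2, et; rewrite k1, k2 in x1.
  pose proof (composes_cancel x1 C) as ev.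
  revert y1; rewrite (comp_reassoc h1), (comp_reassoc h2).
  rewrite (comp_reassoc (eq_sym et)); rassoc; rewrite k1, k2, ev; auto.
- apply PointHom_eq; reflexivity.
Qed.

(** An action is a division: its base component is the target map and its top
    component divides. The unit law says that [(s f x)^-1 x = x]; the
    associativity law gives the target of a quotient on bases and the last law
    of a division on tops. *)
Lemma point_lift_algebra (P : Point E)
    (a : PointHom (source_point (free_groupoid P)) P) :
  Point_comp a (point_unit P) = Point_id P ->
  Point_comp a (source_map (point_free_map a))
  = Point_comp a (source_map
      (point_transpose (Point_id (source_point (free_groupoid P))))) ->
  exists (X : Groupoid E) (i : PointHom (source_point X) P)
      (k : PointHom P (source_point X)), @inverse (Pt E) _ _ i k /\
    Point_comp i (source_map (point_transpose (Point_id (source_point X))))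
    = Point_comp a (source_map (point_free_map i)).
Proof.
intros eu ea.
destruct (point_action (free_groupoid P)) as [m0 m1].
destruct (point_free_map_spec a) as [a0 [a1 a2]].
pose proof (f_equal (@hbase _ _ _) eu) as ub.
pose proof (f_equal (@htop _ _ _) eu) as ut.
pose proof (f_equal (@hbase _ _ _) ea) as ab.
pose proof (f_equal (@htop _ _ _) ea) as at'.
pose proof (hepi a) as he; pose proof (hsec a) as hs.
clear eu ea; cbn in ub, ut, ab, at', he, hs; cbn in m0, m1, a0, a1, a2.
rewrite a0, m0 in ab; apply free_composes in m1; destruct m1 as [m1 [m2 m3]].
unshelve epose (V := @Build_Division P (hbase a) (htop a) ub he ab _ _ _).
{ exists (based_pair P); rewrite based_pair_r0, based_pair_r1; auto. }
{ exists (pair (kp_pullback P) (diagonal_epi P)).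
  split; [apply pair_fst|split; [apply pair_snd|exact hs]]. }
{ intros Z x y z u v w [kx [x1 [x2 <-]]] [ky [y1 [y2 <-]]] [kz [z1 [z2 <-]]].
  destruct (pullback_pair (kp_pullback (kp_point P)) (a := kx) (b := ky))
    as [k [k1 k2]]; [cbn; congruence|].
  cbn in k1, k2.
  exists (f1 (point_free_map a) ∘ k); cbn.
  rewrite (comp_reassoc a1), (comp_reassoc a2), (comp_reassoc at'); rassoc.
  split; [exact (f_equal (comp (htop a)) k1)|].
  split; [exact (f_equal (comp (htop a)) k2)|].
  apply (f_equal (comp (htop a))), kp_joint.
  - rewrite (comp_reassoc (eq_sym m1)), z1, <- x2, <- k1, comp_assoc; auto.
  - rewrite (comp_reassoc (eq_sym m3)), z2, <- y2, <- k2, comp_assoc; auto. }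
set (X := groupoid_of_division V).
unshelve epose (i := @Build_PointHom E (source_point X) P
  (idm (pbase P)) (idm (ptop P)) _ _).
{ cbn; rewrite comp_id_l, comp_id_r; reflexivity. }
{ cbn; rewrite comp_id_l, comp_id_r; reflexivity. }
unshelve epose (k := @Build_PointHom E P (source_point X)
  (idm (pbase P)) (idm (ptop P)) _ _).
{ cbn; rewrite comp_id_l, comp_id_r; reflexivity. }
{ cbn; rewrite comp_id_l, comp_id_r; reflexivity. }
exists X, i, k; split.
{ split; apply PointHom_eq; apply comp_id_l. }
destruct (point_action X) as [n0 n1].
destruct (point_free_map_spec i) as [i0 [i1 i2]].
apply PointHom_eq; cbn.
- rewrite n0, i0, comp_id_l; symmetry; apply comp_id_r.
- apply groupoid_of_division_composes in n1; destruct n1 as [l [l1 [l2 l3]]].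
  cbn in i1, i2, l3; rewrite comp_id_l in i1, i2 |- *; rewrite <- l3.
  apply (f_equal (comp (htop a))), kp_joint; [rewrite l1|rewrite l2];
    symmetry; assumption.
Qed.

Definition Source_monadic : Monadic Source.
Proof.
unshelve refine (@Build_Monadic (Pt E) (Grd E) Source
  free_groupoid point_unit point_transpose _ _ _ _ _).
- intros P X h; apply is_transpose_unit, point_transpose_spec.
- intros P X k k' e.
  apply (is_transpose_unique (unit_is_transpose k)).
  change (is_transpose (fmap Source k ∘ (point_unit P : Hom (P : Pt E) _)) k').
  rewrite e; apply unit_is_transpose.
- intros X Y k k' e; apply GroupoidHom_eq;
    [apply (f_equal (@hbase _ _ _) e)|apply (f_equal (@htop _ _ _) e)].
- apply point_lift_hom.
- apply point_lift_algebra.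
Defined.

Lemma DiF_iff_cartesian (X Y : Grd E) (k : Hom X Y) :
  DiF k <-> P_cartesian (fmap Source k).
Proof. symmetry; apply cartesian_iff_pullback. Qed.

Lemma point_unit_cartesian (P : Point E) :
  P_cartesian (point_unit P : Hom (P : Pt E) _).
Proof.
apply cartesian_iff_pullback; cbn; apply pullback_intro.
- apply based_pair_r0.
- intros Z a b e; exists (r1 ∘ a).
  assert (eb : pepi P ∘ (r1 ∘ a) = b).
  { rewrite <- kp_epi, e; rw (psplit P); apply comp_id_l. }
  split; [apply kp_joint|exact eb].
  + rewrite (comp_reassoc (based_pair_r0 P)); rassoc; rewrite eb; auto.
  + rewrite (comp_reassoc (based_pair_r1 P)), comp_id_l; auto.
- intros Z u v e _; rewrite <- (comp_id_l u), <- (comp_id_l v).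
  rewrite <- based_pair_r1; rassoc; rewrite e; reflexivity.
Qed.

(** A fibre of the kernel pair of [P] is a fibre of [P], and these are in
    bijection with fibres of [Q] when [h] is cartesian. *)
Lemma free_map_cartesian (P Q : Point E) (h : PointHom P Q) :
  P_cartesian (h : Hom (P : Pt E) Q) ->
  P_cartesian (source_map (point_free_map h) : Hom (source_point _ : Pt E) _).
Proof.
destruct (point_free_map_spec h) as [h0 [h1 h2]].
intros c; apply cartesian_iff_pullback in c; apply cartesian_iff_pullback.
cbn in *; rewrite h0; apply pullback_intro.
- exact h1.
- intros Z a b e.
  destruct (pullback_pair c (a := r1 ∘ a) (b := pepi P ∘ b)) as [x [x1 x2]].
  { rewrite <- kp_epi, e, !comp_assoc, hepi; reflexivity. }
  destruct (pullback_pair (kp_pullback P) (eq_sym x2)) as [u [u1 u2]].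
  exists u; split; [apply kp_joint|exact u1].
  + rewrite (comp_reassoc h1); rassoc; rewrite u1; auto.
  + rewrite (comp_reassoc h2); rassoc; rewrite u2; auto.
- intros Z u v e1 e2; apply kp_joint; [exact e2|].
  apply (pullback_joint c).
  + rewrite !comp_assoc, <- h2; rassoc; rewrite e1; reflexivity.
  + rewrite <- !kp_epi, e2; reflexivity.
Qed.

Lemma free_map_pullbacks (P A B K : Pt E)
    (p : Hom P A) (q : Hom P B) (f : Hom A K) (g : Hom B K) :
  is_pullback p q f g ->
  @is_pullback (Pt E) (source_point _) (source_point _) (source_point _)
    (source_point _)
    (source_map (point_free_map p)) (source_map (point_free_map q))
    (source_map (point_free_map f)) (source_map (point_free_map g)).
Proof.
intros pb; destruct (point_pullback_components pb) as [pt pb_base].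
destruct (point_free_map_spec p) as [hp [p1' p2']].
destruct (point_free_map_spec q) as [hq [q1' q2']].
destruct (point_free_map_spec f) as [hf [f1' f2']].
destruct (point_free_map_spec g) as [hg [g1' g2']].
apply point_pullback_of_components; cbn.
2: rewrite hp, hq, hf, hg; exact pt.
cbn in *; apply pullback_intro.
- apply kp_joint.
  + rewrite !comp_assoc, f1', g1'; rassoc; rewrite p1', q1', !comp_assoc.
    rewrite (proj1 pt); reflexivity.
  + rewrite !comp_assoc, f2', g2'; rassoc; rewrite p2', q2', !comp_assoc.
    rewrite (proj1 pt); reflexivity.
- intros Z a b e.
  destruct (pullback_pair pt (a := r0 ∘ a) (b := r0 ∘ b)) as [x [x1 x2]].
  { rewrite (comp_reassoc (eq_sym f1')), (comp_reassoc (eq_sym g1')); rassoc.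
    rewrite e; reflexivity. }
  destruct (pullback_pair pt (a := r1 ∘ a) (b := r1 ∘ b)) as [y [y1 y2]].
  { rewrite (comp_reassoc (eq_sym f2')), (comp_reassoc (eq_sym g2')); rassoc.
    rewrite e; reflexivity. }
  destruct (pullback_pair (kp_pullback P) (a := x) (b := y)) as [u [u1 u2]].
  { apply (pullback_joint pb_base).
    - rewrite !comp_assoc, <- hepi; rassoc; rewrite x1, y1; apply kp_epi.
    - rewrite !comp_assoc, <- hepi; rassoc; rewrite x2, y2; apply kp_epi. }
  exists u; split; apply kp_joint.
  + rewrite (comp_reassoc p1'); rassoc; rewrite u1; auto.
  + rewrite (comp_reassoc p2'); rassoc; rewrite u2; auto.
  + rewrite (comp_reassoc q1'); rassoc; rewrite u1; auto.
  + rewrite (comp_reassoc q2'); rassoc; rewrite u2; auto.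
- intros Z u v e1 e2; apply kp_joint; apply (pullback_joint pt);
    rewrite !comp_assoc.
  + rewrite <- p1'; rassoc; rewrite e1; auto.
  + rewrite <- q1'; rassoc; rewrite e2; auto.
  + rewrite <- p2'; rassoc; rewrite e1; auto.
  + rewrite <- q2'; rassoc; rewrite e2; auto.
Qed.

Lemma Source_adapted : Adapted Source_monadic (@P_cartesian E) (@DiF E).
Proof.
split.
- apply DiF_iff_cartesian.
- intros X Y Z g f; apply cartesian_comp.
- intros X Y Z g f; apply cartesian_cancel.
- intros X Y j k; apply cartesian_iso.
- intros P A B K p q f g pb.
  apply (cartesian_pullback pb), (point_pullback_components pb).
- intros A B K f g; destruct (point_pullback_exists f g) as [P [p [q [h1 h2]]]].
  exists P, p, q; apply (point_pullback_of_components h1 h2).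
- apply free_map_pullbacks.
- apply free_map_cartesian.
- apply point_unit_cartesian.
Qed.

End Concrete.

Theorem theorem3p1 (E : Category) (hE : finitely_complete E) :
  (P_decomposable E <-> has_extremal_decompositions (@DiF E)) /\
  (stably_P_decomposable E <-> has_stably_extremal_decompositions (@DiF E)).
Proof.
split.
- apply (extremal_transfer (Source_adapted hE)).
- apply (stably_extremal_transfer (Source_adapted hE)).
Qed.
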